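(* Let $(r_n)_{n\ge 0}$ be an increasing sequence of real numbers with $0 < r_n<2^{n-10}$ for all $n\ge 0$. Then the set of integers $$A= \mathbb{Z}\cap\bigcup_{n \geq 0} [2^n-r_n,2^n+r_n]$$ is massive if and only if there exists $\varepsilon>0$ such that $r_n > \varepsilon 2^n$ for all $n\ge 0$.
   Context: $\mathbb{T}$ is the unit circle, viewed as the interval $[-\frac12,\frac12]$ with endpoints identified, equipped with Lebesgue probability measure. $C(\mathbb{T})$ is the space of continuous complex-valued functions on $\mathbb{T}$. For an integrable $f$ on $\mathbb{T}$ and $n\in\mathbb{Z}$, the Fourier coefficients are $\hat f(n)=\int_{-1/2}^{1/2} f(t)e^{-2\pi i n t}\,dt$. A set $A\subset\mathbb{Z}$ is called massive if for any sequence $(a_n)_{n\in A}\in\ell^2(A)$ there exists a function $f\in C(\mathbb{T})$ such that $\hat f(n)=0$ for all $n\in\mathbb{Z}\setminus A$ and $|\hat f(n)|\ge |a_n|$ for all $n\in A$. *)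

(* Defs.v *)
From mathcomp Require Import all_boot all_order all_algebra.
From mathcomp Require Import complex.
From mathcomp Require Import all_classical all_reals all_analysis.

Set Implicit Arguments.
Unset Strict Implicit.
Unset Printing Implicit Defensive.

Import Order.TTheory GRing.Theory Num.Theory.
Import numFieldNormedType.Exports.

Local Open Scope classical_set_scope.
Local Open Scope ring_scope.
Local Open Scope complex_scope.

Definition circle (R : realType) : set R := `[- 2^-1, 2^-1].
Arguments circle R : clear implicits.

(* The endpoints of [circle R] are identified; values of [f] outside
   [circle R] are irrelevant. [R[i]^o] carries the topology of the norm of
   [R[i]], that is, of the complex modulus. *)
Definition continuous_on_circle (R : realType) (f : R -> R[i]) : Prop :=
  {within circle R, continuous (f : R -> (R[i])^o)} /\ f (- 2^-1) = f (2^-1).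

Definition expi (R : realType) (x : R) : R[i] := cos x +i* sin x.

(* The library integrates real-valued functions only. *)
Definition circle_integral (R : realType) (f : R -> R[i]) : R[i] :=
  (\int[lebesgue_measure]_(t in circle R) complex.Re (f t))%R +i*
  (\int[lebesgue_measure]_(t in circle R) complex.Im (f t))%R.

Definition fourier_coef (R : realType) (f : R -> R[i]) (n : int) : R[i] :=
  circle_integral (fun t => f t * expi (- (2 * pi * n%:~R * t))).

(* Only the values of [a] on [A] matter. *)
Definition ell2 (R : realType) (A : set int) (a : int -> R[i]) : Prop :=
  summable A (fun n => (complex.Re `|a n| ^+ 2)%:E).

Definition massive (R : realType) (A : set int) : Prop :=
  forall a : int -> R[i], ell2 A a ->
    exists f : R -> R[i],
      [/\ continuous_on_circle f,
          forall n, ~ A n -> fourier_coef f n = 0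
        & forall n, A n -> `|a n| <= `|fourier_coef f n|].

Definition dyadic_intervals (R : realType) (r : nat -> R) : set int :=
  [set m | (\bigcup_n `[2 ^+ n - r n, 2 ^+ n + r n]%classic) m%:~R].

(* Main.v *)
Require Import Defs.
From mathcomp Require Import all_boot all_order all_algebra.
From mathcomp Require Import complex.
From mathcomp Require Import cyclic cyclotomic separable ring lra zify.
From mathcomp Require Import all_classical all_reals all_analysis.

(** Why the theorem holds.

    Long intervals, [r n > eps * 2 ^+ n]. Everything is done with polynomials on
    the unit circle. A polynomial [f] with [|f| < 1] there has a companion [G]: a
    polynomial of at most twice the degree, without zeros in the closed disc, with
    [|G| = 1 - |f|^2] on the circle ([outer_factor]). If [|w| <= b |G|] then
    [f + w] and [f - w] still have companions, and the product of the moduli at 0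
    of these is at least [1 - 6 b^2] times [|G(0)|^2]: the first order terms cancel
    and the maximum principle transports the inequality from the circle to the
    origin ([admissible_perturb]). So additions are paid for in squares, in
    accordance with the assumption that the coefficients are in l2.

    This is used twice. Inside one block, it makes a variational argument in the
    manner of Bang's plank lemma work for analytic polynomials: near a maximum,
    over signs [e i] and over [p] with companion [P], of
    [sum_i e_i b_i Re p^(i) + 4 |P(0)|], the comparison with [p + w] and with
    [p - w] and the sign [e i] flipped, where [w] is a small multiple of ['X^i * P],
    shows that [|p^(i)|] is at least a constant times [b_i] ([bang_step],
    [bang_block]). One obtains polynomials with spectrum in a given interval, all
    of its coefficients large, and bounded by a constant times the l2 norm of the
    prescribed coefficients times [|H|], for any suitable [H] of small degree
    ([block_polynomial]). Between blocks, the
    polynomials of sparse blocks are added one after the other, each dominated by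
    the companion of the sum of the preceding ones, with the better of the two
    signs; all partial sums are bounded by 1 ([polynomial_chain]). The degree of
    the companion is small compared with the next block because the intervals are
    comparable to [2 ^ n] and only every [C]-th one is taken. Weights tending to
    zero make the sum uniformly convergent ([sparse_blocks_function]), and the [C]
    functions obtained have disjoint spectra.

    Short intervals. If [r n / 2 ^+ n] is not bounded below then, [r] being
    nondecreasing, there are arbitrarily long windows of exponents in which the
    intervals are much shorter than every [2 ^ k] of the window. A Riesz product
    built on every second power of two of the window then has no frequency in the
    spectrum but these powers, and hence the sum of the moduli of the coefficients of
    [f] at these powers is at most twice the supremum of [Re f] ([riesz_product]).
    Some sequence in l2 violates this in longer and longer windows
    ([not_massive]). *)

Set Implicit Arguments.
Unset Strict Implicit.
Unset Printing Implicit Defensive.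

Import Order.TTheory GRing.Theory Num.Theory.
Import numFieldNormedType.Exports.

Local Open Scope classical_set_scope.
Local Open Scope ring_scope.

(** * The modulus of a complex number, as a real number *)

Section Modulus.
Variable R : realType.
Implicit Types (x y : R) (z w : R[i]).

Definition cmod z : R := complex.Re `|z|.

Lemma normc_cmod z : `|z| = (cmod z)%:C%C.
Proof. by rewrite /cmod normc_def. Qed.

Lemma cmodE z : cmod z = Num.sqrt (complex.Re z ^+ 2 + complex.Im z ^+ 2).
Proof. by rewrite /cmod normc_def. Qed.

Lemma cmod_ge0 z : 0 <= cmod z.
Proof. by rewrite cmodE sqrtr_ge0. Qed.

Lemma sqr_cmod z : cmod z ^+ 2 = complex.Re z ^+ 2 + complex.Im z ^+ 2.
Proof. by rewrite cmodE sqr_sqrtr // addr_ge0 ?sqr_ge0. Qed.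

Lemma cmodM z w : cmod (z * w) = cmod z * cmod w.
Proof. by apply: complexI; rewrite rmorphM /= -!normc_cmod normrM. Qed.

Lemma cmodX z n : cmod (z ^+ n) = cmod z ^+ n.
Proof. by apply: complexI; rewrite rmorphXn /= -!normc_cmod normrX. Qed.

Lemma cmodV z : cmod z^-1 = (cmod z)^-1.
Proof. by apply: complexI; rewrite fmorphV /= -!normc_cmod normfV. Qed.

Lemma cmodN z : cmod (- z) = cmod z.
Proof. by rewrite /cmod normrN. Qed.

Lemma cmod0 : cmod 0 = 0.
Proof. by rewrite /cmod normr0. Qed.

Lemma cmod1 : cmod 1 = 1.
Proof. by rewrite /cmod normr1. Qed.

Lemma cmodJ z : cmod z^*%C = cmod z.
Proof. by rewrite /cmod normcJ. Qed.

Lemma cmod_real x : cmod x%:C%C = `|x|.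
Proof. by rewrite cmodE /= expr0n /= addr0 sqrtr_sqr. Qed.

Lemma ler_cmodD z w : cmod (z + w) <= cmod z + cmod w.
Proof. by rewrite -lecR rmorphD /= -!normc_cmod ler_normD. Qed.

Lemma cmod_eq0 z : (cmod z == 0) = (z == 0).
Proof.
by rewrite -(normr_eq0 z) normc_cmod; apply/eqP/eqP => [->//|/complexI].
Qed.

Lemma cmod_gt0 z : (0 < cmod z) = (z != 0).
Proof. by rewrite lt_neqAle cmod_ge0 andbT eq_sym cmod_eq0. Qed.

Lemma ler_cmod_sum (I : Type) (s : seq I) (P : pred I) (F : I -> R[i]) :
  cmod (\sum_(i <- s | P i) F i) <= \sum_(i <- s | P i) cmod (F i).
Proof.
elim/big_ind2: _ => [|a b c d h1 h2|//]; first by rewrite cmod0.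
exact: le_trans (ler_cmodD _ _) (lerD h1 h2).
Qed.

Lemma cmod_prod (I : Type) (s : seq I) (P : pred I) (F : I -> R[i]) :
  cmod (\prod_(i <- s | P i) F i) = \prod_(i <- s | P i) cmod (F i).
Proof. by apply: (big_morph cmod cmodM cmod1). Qed.

Lemma Re_le_cmod z : `|complex.Re z| <= cmod z.
Proof. by rewrite -lecR -normc_cmod normc_ge_Re. Qed.

Lemma Im_le_cmod z : `|complex.Im z| <= cmod z.
Proof. by rewrite cmodE -sqrtr_sqr ler_wsqrtr // lerDr sqr_ge0. Qed.

Lemma cmod_le_ReIm z : cmod z <= `|complex.Re z| + `|complex.Im z|.
Proof.
rewrite cmodE -[leRHS]ger0_norm; last by rewrite addr_ge0 ?normr_ge0.
rewrite -sqrtr_sqr ler_wsqrtr // sqrrD !real_normK ?num_real //.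
by rewrite addrAC lerDl mulrn_wge0 // mulr_ge0.
Qed.

Lemma mulcJ z : z * z^*%C = ((cmod z) ^+ 2)%:C%C.
Proof. by rewrite -sqr_normc normc_cmod rmorphXn. Qed.

Lemma ReD z w : complex.Re (z + w) = complex.Re z + complex.Re w.
Proof. by case: z w => [a b] [c d]. Qed.

Lemma ImD z w : complex.Im (z + w) = complex.Im z + complex.Im w.
Proof. by case: z w => [a b] [c d]. Qed.

Lemma ReN z : complex.Re (- z) = - complex.Re z.
Proof. by case: z. Qed.

Lemma ImN z : complex.Im (- z) = - complex.Im z.
Proof. by case: z. Qed.

Lemma Re_sum (I : Type) (s : seq I) (P : pred I) (F : I -> R[i]) :
  complex.Re (\sum_(i <- s | P i) F i) = \sum_(i <- s | P i) complex.Re (F i).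
Proof. by apply: (big_morph (@complex.Re R) ReD). Qed.

Lemma Im_sum (I : Type) (s : seq I) (P : pred I) (F : I -> R[i]) :
  complex.Im (\sum_(i <- s | P i) F i) = \sum_(i <- s | P i) complex.Im (F i).
Proof. by apply: (big_morph (@complex.Im R) ImD). Qed.

Lemma ReZ x z : complex.Re (x%:C%C * z) = x * complex.Re z.
Proof. by case: z => a b /=; rewrite mul0r subr0. Qed.

Lemma sqr_cmodD z w :
  cmod (z + w) ^+ 2 = cmod z ^+ 2 + cmod w ^+ 2 + 2 * complex.Re (z^*%C * w).
Proof.
by rewrite !sqr_cmod; case: z w => [a b] [c d] /=; ring.
Qed.

End Modulus.

(** * Polynomials on the unit circle *)

Section Polynomials.
Variable R : realType.
Implicit Types (z w : R[i]) (f g p q : {poly R[i]}).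

Lemma unit_root_exists N : (0 < N)%N -> exists z : R[i], N.-primitive_root z.
Proof.
move=> N0; have [rs Drs] := closed_field_poly_normal ('X^N - 1 : {poly R[i]}).
have lcN : lead_coef ('X^N - 1 : {poly R[i]}) = 1.
  by rewrite -[1]/(1%:P) lead_coefXnsubC.
rewrite lcN scale1r in Drs.
have rN1 : all N.-unity_root rs.
  by apply/allP => z; rewrite -root_prod_XsubC -Drs.
have ur : uniq rs.
  rewrite -separable_prod_XsubC -Drs separable_Xn_sub_1 //.
  by rewrite pnatr_eq0 -lt0n.
have sr : (size rs >= N)%N.
  by rewrite -ltnS -(size_prod_XsubC _ id) -Drs size_XnsubC.
have /hasP[z _ pz] := has_prim_root N0 rN1 ur sr.
by exists z.
Qed.

Lemma unit_root_cmod N z : N.-primitive_root z -> cmod z = 1.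
Proof.
move=> pz; apply/eqP; rewrite -(pexpr_eq1 (prim_order_gt0 pz)) ?cmod_ge0 //.
by rewrite -cmodX (prim_expr_order pz) cmod1.
Qed.

Lemma circle_mulJ z : cmod z = 1 -> z * z^*%C = 1.
Proof. by move=> z1; rewrite mulcJ z1 expr1n. Qed.

Lemma sum_unit_root N z (i j : 'I_N) : N.-primitive_root z ->
  \sum_(k < N) (z ^+ k) ^+ i * ((z ^+ k) ^+ j)^*%C = (if i == j then N%:R else 0).
Proof.
move=> pz; have z1 := circle_mulJ (unit_root_cmod pz).
set y := z ^+ i * (z ^+ j)^*%C.
have -> : \sum_(k < N) (z ^+ k) ^+ i * ((z ^+ k) ^+ j)^*%C = \sum_(k < N) y ^+ k.
  apply: eq_bigr => k _.
  by rewrite exprMn -rmorphXn /= -!exprM ![(_ * k)%N]mulnC.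
have zjK : z ^+ j * (z ^+ j)^*%C = 1 by rewrite rmorphXn /= -exprMn z1 expr1n.
case: eqP => [ij|/eqP nij].
  have -> : y = 1 by rewrite /y ij zjK.
  by under eq_bigr do rewrite expr1n; rewrite sumr_const card_ord.
have y1 : y != 1.
  apply/eqP => y1; have : z ^+ i = z ^+ j.
    by rewrite -[LHS]mulr1 -zjK mulrCA -/y y1 mulr1.
  move/eqP; rewrite (eq_prim_root_expr pz) !modn_small //.
  by move=> /eqP/val_inj/eqP; rewrite (negPf nij).
have yN : y ^+ N = 1.
  rewrite exprMn -rmorphXn /= -!exprM ![(_ * N)%N]mulnC !exprM.
  by rewrite (prim_expr_order pz) !expr1n rmorph1 mulr1.
apply: (mulfI (x := y - 1)); first by rewrite subr_eq0.
by rewrite -subrX1 yN subrr mulr0.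
Qed.

(** At roots of unity of order [N] no two frequencies below [N] are confused,
    so averages over them may stand for integrals over the circle. *)
Lemma parseval N z f g : N.-primitive_root z -> (size f <= N)%N ->
  (size g <= N)%N ->
  \sum_(k < N) f.[z ^+ k] * (g.[z ^+ k])^*%C
    = N%:R * \sum_(i < N) f`_i * (g`_i)^*%C.
Proof.
move=> pz sf sg.
have E k : f.[z ^+ k] * (g.[z ^+ k])^*%C = \sum_(i < N) \sum_(j < N)
    (f`_i * (g`_j)^*%C) * ((z ^+ k) ^+ i * ((z ^+ k) ^+ j)^*%C).
  rewrite (horner_coef_wide _ sf) (horner_coef_wide _ sg) rmorph_sum /=.
  rewrite mulr_suml; apply: eq_bigr => i _.
  rewrite mulr_sumr; apply: eq_bigr => j _.
  by rewrite rmorphM /= mulrACA.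
under eq_bigr do rewrite E.
rewrite /= exchange_big mulr_sumr; apply: eq_bigr => i _.
rewrite exchange_big (bigD1 i) //= -mulr_sumr sum_unit_root // eqxx mulrC.
rewrite big1 ?addr0 // => j ji.
by rewrite -mulr_sumr sum_unit_root // eq_sym (negPf ji) mulr0.
Qed.

Lemma bessel f n (B : R) : 0 <= B ->
  (forall z, cmod z = 1 -> cmod f.[z] <= B) ->
  \sum_(i < n) cmod f`_i ^+ 2 <= B ^+ 2.
Proof.
move=> B0 fB; set N := (maxn (size f) n).+1.
have [z pz] := unit_root_exists (ltn0Sn (maxn (size f) n)).
have sf : (size f <= N)%N by rewrite /N; lia.
have nN : (n <= N)%N by rewrite /N; lia.
have := parseval pz sf sf; rewrite -/N.
under eq_bigr do rewrite mulcJ.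
under [in X in _ * X]eq_bigr do rewrite mulcJ.
rewrite -!rmorph_sum /= -[N%:R](rmorph_nat (real_complex R)) -rmorphM /=.
move=> /complexI E.
have : N%:R * \sum_(i < N) cmod f`_i ^+ 2 <= N%:R * B ^+ 2.
  have -> : N%:R * B ^+ 2 = \sum_(k < N) B ^+ 2.
    by rewrite sumr_const card_ord mulr_natl.
  rewrite -E.
  apply: ler_sum => k _; rewrite ler_sqr ?nnegrE ?cmod_ge0 //.
  by apply: fB; rewrite cmodX (unit_root_cmod pz) expr1n.
rewrite ler_pM2l ?ltr0Sn //; apply: le_trans.
rewrite -(big_mkord xpredT (fun i => cmod f`_i ^+ 2)).
rewrite -(big_mkord xpredT (fun i => cmod f`_i ^+ 2)).
rewrite [leRHS](big_cat_nat (n := n)) //= lerDl.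
by apply: sumr_ge0 => i _; rewrite sqr_ge0.
Qed.

Lemma cmod_coef0_le f (B : R) : 0 <= B ->
  (forall z, cmod z = 1 -> cmod f.[z] <= B) -> cmod f`_0 <= B.
Proof.
move=> B0 /(bessel 1 B0); rewrite big_ord1.
by rewrite ler_sqr // nnegrE cmod_ge0.
Qed.

Definition cesaro M p : {poly R[i]} :=
  \poly_(j < M) ((1 - j%:R / M%:R) * p`_j).

(** Cesaro means are averages of translates of [p] against Fejer's kernel, which
    is positive because it is the square of the modulus of the polynomial [D]
    below. *)
Lemma cesaro_bound M p (B : R) : 0 <= B ->
  (forall z, cmod z = 1 -> cmod p.[z] <= B) ->
  forall z, cmod z = 1 -> cmod (cesaro M p).[z] <= B.
Proof.
case: M => [|M] B0 pB w w1.
  by rewrite (_ : cesaro _ _ = 0) ?horner0 ?cmod0 // /cesaro poly_def big_ord0.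
set m := M.+1.
pose D : {poly R[i]} := \poly_(j < m) 1.
have sD : (size D <= m)%N by apply: size_poly.
pose q : {poly R[i]} := \poly_(j < size p) (w ^+ j * p`_j).
have sq : (size q <= size p)%N by apply: size_poly.
have qE x : q.[x] = p.[w * x].
  rewrite horner_poly horner_coef; apply: eq_bigr => j _.
  by rewrite exprMn mulrCA !mulrA.
(* [N] exceeds the degrees of both [q * D] and [D] *)
set N := (size p + m)%N.
have N0 : (0 < N)%N by rewrite /N; lia.
have [z pz] := unit_root_exists N0.
have sqD : (size (q * D)%R <= N)%N.
  by apply: leq_trans (size_polyMleq _ _) _; rewrite /N; lia.
have sD' : (size D <= N)%N by rewrite /N; lia.
have coefq j : q`_j = w ^+ j * p`_j.
  by rewrite coef_poly; case: ltnP => // h; rewrite nth_default ?mulr0.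
have tail0 (F : nat -> R[i]) : \sum_(m <= i < N) F i * (D`_i)^*%C = 0.
  rewrite big_nat_cond big1 // => i /andP[/andP[mi _] _].
  by rewrite [D`_i]nth_default ?rmorph0 ?mulr0 // (leq_trans sD).
have E1 : m%:R * (cesaro m p).[w] = \sum_(i < N) (q * D)`_i * (D`_i)^*%C.
  rewrite horner_poly mulr_sumr.
  rewrite -(big_mkord xpredT (fun i => (q * D)`_i * (D`_i)^*%C)).
  rewrite (big_cat_nat (n := m)) //=; last by rewrite /N; lia.
  rewrite [X in _ + X]tail0 addr0.
  rewrite big_mkord.
  under [RHS]eq_bigr => i _.
    rewrite [D`_i]coef_poly ltn_ord rmorph1 mulr1 coefMr.
    rewrite (eq_bigr (fun j : 'I_i.+1 => (w ^+ (i - j) * p`_(i - j)))); last first.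
      move=> j _; rewrite coefq coef_poly.
      by rewrite (leq_ltn_trans _ (ltn_ord i)) ?mulr1 // -ltnS.
    rewrite (reindex_inj rev_ord_inj) /=.
    rewrite (eq_bigr (fun j : 'I_i.+1 => (w ^+ j * p`_j))); last first.
      by move=> j _; rewrite subSS subKn // -ltnS.
    rewrite (big_ord_widen m (fun j => w ^+ j * p`_j)) // big_mkcond.
    over.
  rewrite /= exchange_big; apply: eq_bigr => j _ /=.
  rewrite -big_mkcond /= sumr_const.
  have -> : #|[pred i : 'I_m | (j < i.+1)%N]| = (m - j)%N.
    rewrite -sum1_card -(big_mkord (fun i => (j < i.+1)%N) (fun=> 1%N)).
    rewrite (big_cat_nat (n := j)) //=; last exact/ltnW.
    rewrite big_nat_cond big_pred0 => [|i]; last by lia.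
    rewrite add0n big_nat_cond (eq_bigl (fun i => (j <= i < m)%N)) => [|i].
      by rewrite -big_nat sum_nat_const_nat muln1.
    by lia.
  rewrite -[RHS]mulr_natl natrB; last exact/ltnW.
  have m0 : m%:R != 0 :> R[i] by rewrite pnatr_eq0.
  by field.
have E2 : N%:R * (m%:R * (cesaro m p).[w])
    = \sum_(k < N) q.[z ^+ k] * ((cmod D.[z ^+ k]) ^+ 2)%:C%C.
  rewrite E1 -(parseval pz) //; apply: eq_bigr => k _.
  by rewrite hornerM -mulrA mulcJ.
have E3 : N%:R * m%:R = \sum_(k < N) (cmod D.[z ^+ k]) ^+ 2.
  apply: complexI; rewrite rmorph_sum rmorphM !rmorph_nat /=.
  under eq_bigr do rewrite -mulcJ.
  rewrite (parseval pz) //; congr (_ * _).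
  rewrite -(big_mkord xpredT (fun i => D`_i * (D`_i)^*%C)).
  rewrite (big_cat_nat (n := m)) //=; last by rewrite /N; lia.
  rewrite [X in _ = _ + X]tail0 addr0.
  rewrite big_mkord.
  have -> : m%:R = \sum_(i < m) 1 :> R[i] by rewrite sumr_const card_ord.
  apply: eq_bigr => i _; by rewrite coef_poly ltn_ord rmorph1 mulr1.
have Nm0 : 0 < N%:R * m%:R :> R by rewrite mulr_gt0 ?ltr0n.
rewrite -(ler_pM2l Nm0) {2}E3 mulr_suml -{1}[N%:R * _]ger0_norm ?(ltW Nm0) //.
rewrite -cmod_real -cmodM rmorphM /= !rmorph_nat -mulrA E2.
apply: le_trans (ler_cmod_sum _ _ _) _; apply: ler_sum => k _.
rewrite cmodM cmod_real ger0_norm ?sqr_ge0 // mulrC ler_wpM2l ?sqr_ge0 //.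
rewrite qE; apply: pB.
by rewrite cmodM w1 cmodX (unit_root_cmod pz) expr1n mulr1.
Qed.

End Polynomials.

(** * Zero-free polynomials and companions *)

Section Outer.
Variable R : realType.
Implicit Types (z : R[i]) (f g p q w X Y G : {poly R[i]}).

(** Zero-free polynomials on the closed unit disc play the part of outer
    functions: only their moduli on the circle and at the origin matter. *)
Definition zero_free G := forall z, cmod z <= 1 -> G.[z] != 0.

Lemma cvg_prod_geometric (rs : seq R) : (forall x, x \in rs -> 0 <= x < 1) ->
  (fun n => \prod_(x <- rs) (1 + x ^+ n)) @ \oo --> (1 : R).
Proof.
elim: rs => [|x rs IH] xs.
  under eq_fun do rewrite big_nil; exact: cvg_cst.
under eq_fun do rewrite big_cons.
have /andP[x0 x1] := xs x (mem_head _ _).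
have cx : (fun n => 1 + x ^+ n) @ \oo --> 1 + (0 : R).
  by apply: cvgD; [exact: cvg_cst | apply: cvg_expr; rewrite ger0_norm].
have := cvgM cx (IH _); rewrite addr0 mulr1; apply => y yrs.
by apply: xs; rewrite inE yrs orbT.
Qed.

(** The reciprocal of [Y] is replaced by products of truncated geometric
    series, which keeps everything polynomial. *)
Lemma maximum_principle X Y : zero_free Y ->
  (forall z, cmod z = 1 -> cmod X.[z] <= cmod Y.[z]) ->
  cmod X`_0 <= cmod Y`_0.
Proof.
move=> Y0 XY; have [rs DY] := closed_field_poly_normal Y.
have Yn0 : Y != 0.
  by apply: contraNneq (Y0 0 _) => [->|]; rewrite ?horner0 ?cmod0.
have rs1 r : r \in rs -> 1 < cmod r.
  move=> rrs; rewrite ltNge; apply/negP => /Y0/negP[]; rewrite -rootE.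
  by rewrite DY rootZ ?lead_coef_eq0 // root_prod_XsubC.
pose geo n r : {poly R[i]} := \poly_(j < n) r^-1 ^+ j.
pose Q n := \prod_(r <- rs) geo n r.
have geoE n r z : r \in rs ->
    (z - r) * (geo n r).[z] = - r * (1 - (r^-1 * z) ^+ n).
  move=> /rs1 r1; have r0 : r != 0 by rewrite -cmod_gt0; lra.
  have -> : z - r = - r * (1 - r^-1 * z) by field.
  rewrite -mulrA; congr (_ * _).
  have -> : (geo n r).[z] = \sum_(i < n) (r^-1 * z) ^+ i.
    by rewrite horner_poly; apply: eq_bigr => i _; rewrite exprMn.
  by rewrite -opprB mulNr -subrX1 opprB.
have YQ n z : Y.[z] * (Q n).[z] = Y.[0] * \prod_(r <- rs) (1 - (r^-1 * z) ^+ n).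
  rewrite DY !hornerZ !horner_prod -!mulrA; congr (_ * _).
  rewrite -!big_split /= !big_seq; apply: eq_bigr => r rrs.
  by rewrite !hornerXsubC geoE // sub0r.
have bnd n : (0 < n)%N ->
    cmod X`_0 <= cmod Y`_0 * \prod_(x <- [seq (cmod r)^-1 | r <- rs]) (1 + x ^+ n).
  move=> n0; have Q0 : (Q n)`_0 = 1.
    rewrite -horner_coef0 horner_prod big1 // => r _.
    by rewrite horner_coef0 coef_poly n0 expr0.
  have -> : X`_0 = (X * Q n)`_0 by rewrite coef0M Q0 mulr1.
  apply: cmod_coef0_le.
    rewrite mulr_ge0 ?cmod_ge0 // big_map; apply: prodr_ge0 => r _.
    by rewrite addr_ge0 ?exprn_ge0 ?invr_ge0 ?cmod_ge0.
  move=> z z1; rewrite hornerM cmodM.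
  apply: (@le_trans _ _ (cmod (Y.[z] * (Q n).[z]))).
    by rewrite cmodM ler_wpM2r ?cmod_ge0 // XY.
  rewrite YQ cmodM horner_coef0 ler_wpM2l ?cmod_ge0 // cmod_prod big_map.
  apply: ler_prod => r _; rewrite cmod_ge0 /=.
  apply: le_trans (ler_cmodD _ _) _.
  by rewrite cmodN cmod1 cmodX cmodM cmodV z1 mulr1.
have cv : (fun n => cmod Y`_0 *
    \prod_(x <- [seq (cmod r)^-1 | r <- rs]) (1 + x ^+ n)) @ \oo --> cmod Y`_0.
  have := cvgM (cvg_cst (cmod Y`_0)) (@cvg_prod_geometric
    [seq (cmod r)^-1 | r <- rs] _); rewrite mulr1; apply.
  move=> x /mapP[r /rs1 r1 ->].
  by rewrite invr_ge0 cmod_ge0 invf_lt1 //; lra.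
rewrite -(cvg_lim _ cv) //; apply: limr_ge; first by apply/cvg_ex; eexists; exact: cv.
by exists 1%N => // n /= n0; exact: bnd.
Qed.

(** [1 - |f|^2] is the modulus on the circle of a zero-free polynomial of at
    most twice the degree of [f]: reflect across the circle the zeros that the
    polynomial ['X^d - f * rev f] has in the disc. *)
Lemma outer_factor f d : (size f <= d.+1)%N ->
  (forall z, cmod z = 1 -> cmod f.[z] < 1) ->
  exists G, [/\ (size G <= (2 * d).+1)%N, zero_free G &
    forall z, cmod z = 1 -> cmod G.[z] = 1 - cmod f.[z] ^+ 2].
Proof.
move=> sf f1; pose rf : {poly R[i]} := \poly_(i < d.+1) (f`_(d - i))^*%C.
have rfE z : cmod z = 1 -> rf.[z] = z ^+ d * (f.[z])^*%C.
  move=> z1; rewrite horner_poly (horner_coef_wide _ sf) rmorph_sum mulr_sumr.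
  rewrite (reindex_inj rev_ord_inj) /=; apply: eq_bigr => i _.
  rewrite subSS subKn; last by rewrite -ltnS.
  rewrite rmorphM mulrCA; congr (_ * _).
  rewrite rmorphXn -{3}(subnK (_ : i <= d)%N); last by rewrite -ltnS.
  by rewrite exprD -mulrA -exprMn circle_mulJ // expr1n mulr1.
(* on the circle [T] is ['X^d] times [1 - |f|^2] *)
pose T := 'X^d - f * rf.
have TE z : cmod z = 1 -> cmod T.[z] = 1 - cmod f.[z] ^+ 2.
  move=> z1; have -> : T.[z] = z ^+ d * (1 - cmod f.[z] ^+ 2)%:C%C.
    rewrite !hornerE rfE // rmorphB /= -mulcJ rmorph1; ring.
  rewrite cmodM cmodX z1 expr1n mul1r cmod_real ger0_norm //.
  by have := f1 _ z1; have := cmod_ge0 f.[z]; nra.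
have Tpos z : cmod z = 1 -> T.[z] != 0.
  move=> z1; rewrite -cmod_gt0 TE //.
  by have := f1 _ z1; have := cmod_ge0 f.[z]; nra.
have Tn0 : T != 0.
  by apply: contraNneq (Tpos 1 (cmod1 _)) => ->; rewrite horner0.
have [rs DT] := closed_field_poly_normal T.
have sT : (size T <= (2 * d).+1)%N.
  apply: leq_trans (size_polyD _ _) _; rewrite size_polyN geq_max size_polyXn.
  apply/andP; split; first by lia.
  apply: leq_trans (size_polyMleq _ _) _.
  have srf : (size rf <= d.+1)%N by apply: size_poly.
  by have := leq_add sf srf; case: (_ + _)%N => //= k; lia.
pose g r : {poly R[i]} := if cmod r <= 1 then 1 - r^*%C *: 'X else 'X - r%:P.
have gE r z : cmod z = 1 -> cmod (g r).[z] = cmod (z - r).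
  move=> z1; rewrite /g; case: ifP => _; last by rewrite hornerXsubC.
  rewrite !hornerE (_ : 1 - _ = z * (z - r)^*%C); first by rewrite cmodM cmodJ z1 mul1r.
  by rewrite rmorphB mulrBr circle_mulJ // [z * _]mulrC.
exists (lead_coef T *: \prod_(r <- rs) g r); split.
- apply: leq_trans (size_scale_leq _ _) _; apply: leq_trans sT.
  rewrite DT size_scale ?lead_coef_eq0 // size_prod_XsubC.
  elim: (rs) => [|r s IH]; first by rewrite big_nil size_poly1.
  rewrite big_cons; apply: leq_trans (size_polyMleq _ _) _.
  have sg : (size (g r) <= 2)%N.
    rewrite /g; case: ifP => _; last by rewrite size_XsubC.
    apply: leq_trans (size_polyD _ _) _; rewrite size_polyN geq_max size_poly1 /=.
    by apply: leq_trans (size_scale_leq _ _) _; rewrite size_polyX.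
  by have := leq_add sg IH; case: (_ + _)%N => //= k; lia.
- move=> z z1; rewrite hornerZ mulf_neq0 ?lead_coef_eq0 // horner_prod.
  rewrite prodf_seq_neq0; apply/allP => r rrs /=.
  have r1 : cmod r != 1.
    apply/eqP => r1; move: (Tpos _ r1); rewrite -rootE DT rootZ ?lead_coef_eq0 //.
    by rewrite root_prod_XsubC rrs.
  rewrite /g; case: ifP => [r1'|/negbT].
    have {r1 r1'} r1 : cmod r < 1 by rewrite lt_neqAle r1.
    rewrite !hornerE subr_eq0; apply/eqP => /(congr1 (@cmod R)).
    rewrite cmod1 cmodM cmodJ => /esym; apply/eqP; rewrite lt_eqF //.
    by have := cmod_ge0 z; have := cmod_ge0 r; nra.
  rewrite -ltNge hornerXsubC subr_eq0 => r1'.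
  by apply: contraTneq z1 => ->; rewrite -ltNge.
- move=> z z1; rewrite -TE // [in RHS]DT !hornerZ !horner_prod !cmodM !cmod_prod.
  by congr (_ * _); apply: eq_bigr => r _; rewrite gE // hornerXsubC.
Qed.

(** [admissible f G] makes [G] a companion of [f]: it is what remains of the
    unit ball after [f], and the size of [G`_0] measures how much of it. *)
Definition admissible f G :=
  zero_free G /\ forall z, cmod z = 1 -> cmod G.[z] <= 1 - cmod f.[z] ^+ 2.

Lemma admissible_lt1 f G z : admissible f G -> cmod z = 1 -> cmod f.[z] < 1.
Proof.
move=> [G0 fG] z1; have := fG _ z1.
have := G0 z; rewrite z1 lexx -cmod_gt0 => /(_ isT).
have := cmod_ge0 f.[z]; nra.
Qed.

Lemma admissible_le1 f G z : admissible f G -> cmod z = 1 -> cmod G.[z] <= 1.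
Proof. by move=> [_ fG] /fG; have := cmod_ge0 f.[z]; nra. Qed.

Lemma admissible01 : admissible 0 1.
Proof.
split=> z _; first by rewrite hornerC oner_neq0.
by rewrite horner0 hornerC cmod0 cmod1; lra.
Qed.

(** Adding [w] and subtracting [w] costs the companion only a second order
    term, because the first order terms cancel in the product of the two values
    of [1 - |f|^2]; the maximum principle carries the resulting inequality from
    the circle to the origin. *)
Lemma admissible_perturb f G w d (b : R) : admissible f G -> 0 <= b <= 4^-1 ->
  (forall z, cmod z = 1 -> cmod w.[z] <= b * cmod G.[z]) ->
  (size f <= d.+1)%N -> (size w <= d.+1)%N ->
  exists Gp Gm, [/\ admissible (f + w) Gp, admissible (f - w) Gm,
    (size Gp <= (2 * d).+1)%N, (size Gm <= (2 * d).+1)%N &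
    (1 - 6 * b ^+ 2) * cmod G`_0 ^+ 2 <= cmod Gp`_0 * cmod Gm`_0].
Proof.
move=> fG /andP[b0 b4] wG sf sw.
have key z : cmod z = 1 -> forall (e : R), e = 1 \/ e = -1 ->
    cmod (f.[z] + e%:C%C * w.[z]) ^+ 2 =
    cmod f.[z] ^+ 2 + cmod w.[z] ^+ 2 + e * (2 * complex.Re (f.[z]^*%C * w.[z])).
  move=> z1 e e1; rewrite sqr_cmodD cmodM cmod_real mulrCA ReZ.
  have -> : `|e| = 1 by case: e1 => ->; rewrite ?normrN normr1.
  by rewrite mul1r mulrCA.
have facts z : cmod z = 1 -> [/\ 0 <= cmod f.[z] < 1,
    0 < cmod G.[z] <= 1 - cmod f.[z] ^+ 2, 0 <= cmod w.[z] <= b * cmod G.[z] &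
    `|complex.Re (f.[z]^*%C * w.[z])| <= cmod f.[z] * cmod w.[z]].
  move=> z1; have f1 := admissible_lt1 fG z1; have [G0 hG] := fG.
  split; rewrite ?cmod_ge0 ?wG ?hG //= ?andbT ?cmod_gt0 ?G0 ?z1 //.
  by apply: le_trans (Re_le_cmod _) _; rewrite cmodM cmodJ.
have lt1 z (e : R) : cmod z = 1 -> e = 1 \/ e = -1 ->
    cmod (f.[z] + e%:C%C * w.[z]) < 1.
  move=> z1 e1; have [/andP[f0 f1] /andP[G0 Gf] /andP[w0 wb]] := facts _ z1.
  rewrite ler_norml => /andP[y1 y2].
  rewrite -(@ltr_pXn2r _ 2) ?nnegrE ?cmod_ge0 // expr1n key //.
  have wt : cmod w.[z] <= 4^-1 * (1 - cmod f.[z] ^+ 2) by nra.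
  by case: e1 => ->; nra.
have sp : (size (f + w)%R <= d.+1)%N.
  by apply: leq_trans (size_polyD _ _) _; rewrite geq_max sf sw.
have sm : (size (f - w)%R <= d.+1)%N.
  by apply: leq_trans (size_polyD _ _) _; rewrite geq_max size_polyN sf sw.
have hp z : (f + w).[z] = f.[z] + (1 : R)%:C%C * w.[z].
  by rewrite hornerD rmorph1 mul1r.
have hm z : (f - w).[z] = f.[z] + (-1 : R)%:C%C * w.[z].
  by rewrite hornerD hornerN rmorphN rmorph1 mulN1r.
have [|Gp [sGp zGp EGp]] := outer_factor sp.
  by move=> z z1; rewrite hp; apply: lt1 => //; left.
have [|Gm [sGm zGm EGm]] := outer_factor sm.
  by move=> z z1; rewrite hm; apply: lt1 => //; right.
exists Gp, Gm; split=> //; try by split=> // z z1; rewrite (EGp, EGm).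
(* [c * G ^+ 2] and [Gp * Gm] are compared on the circle, then at the origin *)
set c : R := 1 - 6 * b ^+ 2.
have c0 : 0 <= c by rewrite /c; nra.
have := @maximum_principle (c%:C%C *: (G ^+ 2)) (Gp * Gm).
rewrite coefZ !coef0M cmodM cmod_real ger0_norm // !cmodM; apply.
  by move=> z z1; rewrite hornerM mulf_neq0 ?zGp ?zGm.
move=> z z1; rewrite hornerZ horner_exp hornerM cmodM cmodX cmodM cmod_real ger0_norm //.
rewrite EGp // EGm // hp hm !key //; [|by right|by left].
have [/andP[f0 f1] /andP[G0 Gf] /andP[w0 wb]] := facts _ z1.
rewrite ler_norml => /andP[y1 y2].
set F := cmod f.[z] in f0 f1 Gf y1 y2 *; set g := cmod G.[z] in G0 Gf wb *.
set W := cmod w.[z] in w0 wb y1 y2 *; set y := complex.Re _ in y1 y2 *.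
have yy : y ^+ 2 <= F ^+ 2 * W ^+ 2 by nra.
set t := 1 - F ^+ 2 in Gf *.
have t0 : 0 <= t by nra.
have t1 : t <= 1 by rewrite /t; nra.
have bt0 : 0 <= b * t by rewrite mulr_ge0.
have Wt : W <= b * t by rewrite (le_trans wb) // ler_wpM2l.
have W2 : W ^+ 2 <= b ^+ 2 * t ^+ 2 by rewrite -exprMn ler_sqr ?nnegrE.
have F2 : F ^+ 2 <= 1 by nra.
have yb : y ^+ 2 <= b ^+ 2 * t ^+ 2.
  apply: le_trans yy _; apply: le_trans W2.
  by rewrite -[leRHS]mul1r ler_wpM2r ?sqr_ge0.
have E : (1 - (F ^+ 2 + W ^+ 2 + 1 * (2 * y))) * (1 - (F ^+ 2 + W ^+ 2 + -1 * (2 * y)))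
   = (t - W ^+ 2) ^+ 2 - 4 * y ^+ 2 by rewrite /t; ring.
rewrite E; apply: (@le_trans _ _ (c * t ^+ 2)).
  by rewrite ler_wpM2l // ler_sqr ?nnegrE // ltW.
have : t ^+ 2 - 2 * t * W ^+ 2 <= (t - W ^+ 2) ^+ 2 by nra.
have : t * W ^+ 2 <= b ^+ 2 * t ^+ 2 by nra.
rewrite /c; nra.
Qed.

End Outer.

(** * Large coefficients in one block *)

Section Block.
Variable R : realType.
Implicit Types (z : R[i]) (f p q w P Q H W : {poly R[i]}).

Definition sgb (e : bool) : R := if e then 1 else -1.

Lemma sgb_cases e : sgb e = 1 \/ sgb e = -1.
Proof. by case: e; [left | right]. Qed.

Lemma norm_sgb e : `|sgb e| = 1.
Proof. by case: e; rewrite ?normrN normr1. Qed.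

(** The energy is a signed sum of coefficients of [p] plus the size of the
    companion. At a near-maximum, compare with the competitors
    [p + w] with the same signs and [p - w] with the [i]-th sign flipped: the
    gain of [w] in the [i]-th coefficient is of first order while the companion
    loses only a second order term, and this forces the [i]-th coefficient to be
    large. *)
Lemma bang_step N (b c : 'I_N -> R) (T : 'I_N -> {poly R[i]} -> R)
    (e : 'I_N -> bool) p P (eta : R) (i : 'I_N) k :
  let Phi (e : 'I_N -> bool) p P :=
    \sum_j b j * sgb (e j) * (T j p + c j) + 4 * cmod P`_0 in
  (forall j p w, T j (p + w) = T j p + T j w) ->
  (forall j p w, T j (p - w) = T j p - T j w) ->
  admissible p P ->
  (forall e' p' P', admissible p' P' -> Phi e' p' P' <= Phi e p P + eta) ->
  0 < b i <= 1 -> 4^-1 <= cmod P`_0 <= 1 ->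
  (exists2 u : R[i], cmod u = 1 & forall s : R, 0 <= s ->
     s * (cmod P`_0 / 6) <= sgb (e i) * T i ((s%:C%C * u) *: ('X^k * P))) ->
  b i ^+ 2 / (48 * 1152) - eta <= b i * (sgb (e i) * (T i p + c i)).
Proof.
move=> Phi TD TB pP opt /andP[b0 b1] /andP[P0 P1] [u u1 Tu].
(* with this [s] the loss [24 * s ^+ 2] is half of the gain [s * b i / 24] *)
have [s sE] : exists s, b i = 1152 * s by exists (b i / 1152); field.
set w := (s%:C%C * u) *: ('X^k * P).
have s0 : 0 <= s by lra.
have s4 : s <= 4^-1 by lra.
pose d := maxn (size p) (size w).
have wP z : cmod z = 1 -> cmod w.[z] <= s * cmod P.[z].
  move=> z1; rewrite hornerZ hornerM hornerXn !cmodM cmod_real cmodX z1 u1.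
  by rewrite expr1n mulr1 mul1r ger0_norm.
have [| | |Pp [Pm [pPp pPm _ _ PpPm]]] := admissible_perturb (d := d) pP _ wP.
- by rewrite s0 s4.
- by rewrite leqW // leq_maxl.
- by rewrite leqW // leq_maxr.
set x := cmod Pp`_0 in PpPm *; set y := cmod Pm`_0 in PpPm *.
have xy : 2 * (1 - 6 * s ^+ 2) * cmod P`_0 <= x + y.
  have x0 : 0 <= x := cmod_ge0 _; have y0 : 0 <= y := cmod_ge0 _.
  have s2 : s ^+ 2 <= 16^-1 by have := ler_pM s0 s0 s4 s4; rewrite -expr2; lra.
  have s2' := sqr_ge0 s.
  have l0 : 0 <= 1 - 6 * s ^+ 2 by lra.
  have l1 : 1 - 6 * s ^+ 2 <= 1 by lra.
  set l := 1 - 6 * s ^+ 2 in PpPm l0 l1 *.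
  have L0 : 0 <= 2 * l * cmod P`_0 by rewrite !mulr_ge0 ?cmod_ge0.
  rewrite -(@ler_pXn2r _ 2) // ?nnegrE; last exact: addr_ge0.
  apply: (@le_trans _ _ (4 * (l * cmod P`_0 ^+ 2))); last first.
    have := sqr_ge0 (x - y); rewrite sqrrB sqrrD; lra.
  rewrite !exprMn -!mulrA.
  have : l ^+ 2 * cmod P`_0 ^+ 2 <= l * cmod P`_0 ^+ 2.
    by rewrite ler_wpM2r ?sqr_ge0 // expr2 ler_piMr.
  lra.
pose e' j := if j == i then ~~ e j else e j.
have h1 := opt e _ _ pPp; have h2 := opt e' _ _ pPm.
have E1 : Phi e (p + w) Pp = \sum_j b j * sgb (e j) * (T j p + c j)
     + \sum_j b j * sgb (e j) * T j w + 4 * x.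
  rewrite /Phi -big_split /=; congr (_ + _); apply: eq_bigr => j _.
  by rewrite TD; ring.
have E2 : Phi e' (p - w) Pm = \sum_j b j * sgb (e' j) * (T j p + c j)
     - \sum_j b j * sgb (e' j) * T j w + 4 * y.
  rewrite /Phi -sumrB /=; congr (_ + _); apply: eq_bigr => j _.
  by rewrite TB; ring.
have flip (F : 'I_N -> R) : \sum_j b j * sgb (e' j) * F j
    = \sum_j b j * sgb (e j) * F j - 2 * (b i * sgb (e i) * F i).
  rewrite (bigD1 i) //= [in RHS](bigD1 i) //= /e' eqxx.
  rewrite (eq_bigr (fun j => b j * sgb (e j) * F j)) => [|j /negPf -> //].
  have -> : sgb (~~ e i) = - sgb (e i) by case: (e i); rewrite /= ?opprK.
  ring.
have := lerD h1 h2; rewrite E1 E2 !flip /Phi.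
have bs := ler_wpM2l (ltW b0) (Tu s s0); rewrite -/w in bs.
have sq : s * b i = 1152 * s ^+ 2 by rewrite sE; ring.
have -> : b i ^+ 2 / (48 * 1152) = 24 * s ^+ 2 by rewrite sE; field.
set S0 := \sum_j _; set S1 := \sum_j _; set v := T i p + c i in bs *.
rewrite -!mulrA in bs *.
set A := b i * (sgb (e i) * T i w) in bs *; set B := b i * (sgb (e i) * v) in bs *.
have : 48 * s ^+ 2 <= A.
  apply: le_trans bs.
  have -> : b i * (s * (cmod P`_0 / 6)) = (s * b i) * (cmod P`_0 / 6) by ring.
  have := sqr_ge0 s; rewrite sq; nra.
have : 2 * cmod P`_0 - 12 * s ^+ 2 <= x + y by nra.
lra.
Qed.

Lemma cesaroD M p w : cesaro M (p + w) = cesaro M p + cesaro M w.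
Proof.
apply/polyP => j; rewrite coefD !coef_poly; case: ifP => _; last by rewrite addr0.
by rewrite coefD mulrDr.
Qed.

Lemma cesaroB M p w : cesaro M (p - w) = cesaro M p - cesaro M w.
Proof.
apply/polyP => j; rewrite coefB !coef_poly; case: ifP => _; last by rewrite subr0.
by rewrite coefB mulrBr.
Qed.

Lemma coef_cesaro_mul M k (x : R[i]) P H : (k < M)%N ->
  (cesaro M (x *: ('X^k * P)) * H)`_k
    = ((1 - k%:R / M%:R : R)%:C%C * x) * (P`_0 * H`_0).
Proof.
move=> kM; rewrite coefM big_ord_recr /= big1 ?add0r => [|j _]; last first.
  by rewrite coef_poly coefZ coefXnM ltn_ord !mulr0 if_same mul0r.
rewrite subnn coef_poly kM coefZ coefXnM ltnn subnn.
by rewrite rmorphB rmorph1 rmorphM fmorphV !rmorph_nat /=; ring.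
Qed.

Lemma exists_phase (v : R[i]) (x : R) : `|x| = 1 -> v != 0 ->
  exists2 u : R[i], cmod u = 1 & u * v = (x * cmod v)%:C%C.
Proof.
move=> x1 v0; have m0 : cmod v != 0 by rewrite cmod_eq0.
exists ((x * cmod v)%:C%C / v); last by rewrite mulfVK.
by rewrite cmodM cmod_real normrM cmodV x1 mul1r ger0_norm ?cmod_ge0 // divff.
Qed.

(** An analytic polynomial has its spectrum to the right of an edge, and its
    Cesaro means cut the spectrum on the other side without any sharp cutoff. The
    coefficient of index [i] is reached from [p] when [i] is in the first half of
    the block, and from [q], read backwards, when it is in the second half: thus
    both edges of the block can be sharp. The signs are chosen jointly for [p] and
    [q], so that their contributions to a coefficient cannot cancel. *)
Lemma bang_block rho s H (b : nat -> R) : (2 * s <= rho)%N ->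
  (forall z, cmod z = 1 -> cmod H.[z] <= 1) -> 2^-1 <= cmod H`_0 ->
  let n := (2 * rho)%N in
  let M := (n.+1 - s)%N in
  (forall i, (i <= n)%N -> 0 <= b i) ->
  (forall i, (i <= n)%N -> (2 * n.+1%:R)^-1 <= b i ^+ 2) ->
  \sum_(i < n.+1) b i ^+ 2 <= 1 ->
  exists p q,
   [/\ forall z, cmod z = 1 -> cmod p.[z] <= 1,
       forall z, cmod z = 1 -> cmod q.[z] <= 1 &
       forall i, (i <= n)%N -> b i / (96 * 1152) <=
          cmod ((cesaro M p * H)`_i + ((cesaro M q * H)`_(n - i))^*%C)].
Proof.
move=> s2 H1 H2 n M b0 bn b1.
have sM : (rho < M)%N by rewrite /M /n; lia.
have M0 : (0 < M)%N by lia.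
have M3 : 3^-1 <= 1 - rho%:R / M%:R :> R.
  have : rho%:R <= 2 / 3 * M%:R :> R.
    have : (3 * rho)%:R <= (2 * M)%:R :> R by rewrite ler_nat /M /n; lia.
    rewrite !natrM; lra.
  have : 0 < M%:R :> R by rewrite ltr0n.
  by move=> ? ?; rewrite lerBrDr -lerBrDl ler_pdivrMr //; lra.
pose T (p : {poly R[i]}) j := (cesaro M p * H)`_j.
have TD p w j : T (p + w) j = T p j + T w j by rewrite /T cesaroD mulrDl coefD.
have TB p w j : T (p - w) j = T p j - T w j by rewrite /T cesaroB mulrBl coefB.
have Tb p P : admissible p P -> \sum_(j < n.+1) cmod (T p j) ^+ 2 <= 1.
  move=> pP; rewrite -[leRHS](expr1n _ 2); apply: bessel => // z z1.
  rewrite hornerM cmodM -[leRHS]mulr1 ler_pM ?cmod_ge0 ?H1 //.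
  by apply: cesaro_bound => // y y1; apply/ltW/(admissible_lt1 pP).
have Hn0 : H`_0 != 0 by rewrite -cmod_gt0; lra.
have Tu P k (e : bool) : zero_free P -> (k <= rho)%N ->
    exists2 u : R[i], cmod u = 1 & forall t : R, 0 <= t ->
     t * (cmod P`_0 / 6)
       <= sgb e * complex.Re (T ((t%:C%C * u) *: ('X^k * P)) k).
  move=> zP kr; have [|u u1 uE] := @exists_phase (P`_0 * H`_0) _ (norm_sgb e).
    rewrite mulf_neq0 //; have := zP 0; rewrite horner_coef0 cmod0.
    by apply; exact: ler01.
  exists u => // t t0; rewrite /T coef_cesaro_mul; last by lia.
  rewrite -!mulrA uE -!rmorphM /=.
  set kM := 1 - _; have hk : 3^-1 <= kM.
    apply: le_trans M3 _; rewrite lerD2l lerN2 ler_wpM2r ?invr_ge0 //.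
    by rewrite ler_nat.
  have ee : sgb e * sgb e = 1 by case: (sgb_cases e) => ->; ring.
  have -> : sgb e * (kM * (t * (sgb e * cmod (P`_0 * H`_0))))
     = (sgb e * sgb e) * (t * (kM * cmod (P`_0 * H`_0))) by ring.
  rewrite ee mul1r ler_wpM2l // cmodM.
  have := cmod_ge0 P`_0; set x := cmod P`_0; set y := cmod H`_0 in H2 *.
  move=> x0; have : 3^-1 * (2^-1 * x) <= kM * (y * x).
    by rewrite ler_pM ?mulr_ge0 ?ler_wpM2r.
  lra.
(* the energy; the factor 4 makes the companions worth more than the
   coefficients, whose sum is at most 2, so a near-maximum keeps them away from 0 *)
pose Phi (e : 'I_n.+1 -> bool) p P q Q :=
  \sum_(j < n.+1) b j * sgb (e j) * (complex.Re (T p j) + complex.Re (T q (n - j)%N))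
  + 4 * cmod P`_0 + 4 * cmod Q`_0.
pose V := [set x | exists e p P q Q,
   [/\ admissible p P, admissible q Q & x = Phi e p P q Q]].
have P1 p P : admissible p P -> cmod P`_0 <= 1.
  move=> pP; apply: cmod_coef0_le => // z z1.
  exact: (admissible_le1 pP).
have sumb e p P q Q : admissible p P -> admissible q Q ->
    Phi e p P q Q <= 2 + 4 * cmod P`_0 + 4 * cmod Q`_0.
  move=> pP qQ; rewrite !lerD2r.
  apply: (@le_trans _ _ (\sum_(j < n.+1) (b j ^+ 2 +
      (2^-1 * cmod (T p j) ^+ 2 + 2^-1 * cmod (T q (n - j)%N) ^+ 2)))).
    apply: ler_sum => j _; have bj : 0 <= b j by apply: b0; rewrite -ltnS.
    set x := T p j; set y := T q _.
    have hx := Re_le_cmod x; have hy := Re_le_cmod y.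
    apply: (@le_trans _ _ (b j * (cmod x + cmod y))).
      rewrite -mulrA ler_wpM2l //; apply: le_trans (ler_norm _) _.
      rewrite normrM norm_sgb mul1r; apply: le_trans (ler_normD _ _) _.
      exact: lerD.
    have := sqr_ge0 (b j - cmod x); have := sqr_ge0 (b j - cmod y).
    rewrite !sqrrB; lra.
  rewrite !big_split /= -!mulr_sumr.
  have -> : \sum_(j < n.+1) cmod (T q (n - j)%N) ^+ 2 = \sum_(j < n.+1) cmod (T q j) ^+ 2.
    rewrite [RHS](reindex_inj rev_ord_inj) /=; apply: eq_bigr => j _.
    by rewrite subSS.
  have := Tb _ _ pP; have := Tb _ _ qQ; lra.
have supV : has_sup V.
  split; first by exists (Phi (fun=> true) 0 1 0 1), (fun=> true), 0, 1, 0, 1;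
    split=> //; exact: admissible01.
  exists 10 => _ [e [p [P [q [Q [pP qQ ->]]]]]].
  apply: le_trans (sumb _ _ _ _ _ pP qQ) _.
  have := P1 _ _ pP; have := P1 _ _ qQ; lra.
pose eta : R := (2 * n.+1%:R)^-1 / (96 * 1152).
have n0 : 0 < n.+1%:R :> R by rewrite ltr0n.
have eta0 : 0 < eta by rewrite divr_gt0 ?invr_gt0 ?mulr_gt0 ?ltr0n.
have eta1 : eta <= 1.
  rewrite /eta ler_pdivrMr ?mulr_gt0 ?ltr0n // mul1r.
  apply: (@le_trans _ _ 1); last lra.
  rewrite invf_le1; last by rewrite mulr_gt0.
  have : 1 <= n.+1%:R :> R by rewrite ler1n.
  lra.
have [_ [e [p [P [q [Q [pP qQ ->]]]]]] hx] := sup_adherent eta0 supV.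
have opt e' p' P' q' Q' : admissible p' P' -> admissible q' Q' ->
    Phi e' p' P' q' Q' <= Phi e p P q Q + eta.
  move=> h1 h2; apply: (@le_trans _ _ (sup V)); last by lra.
  apply: (sup_upper_bound supV); by exists e', p', P', q', Q'.
have T0 j : T 0 j = 0.
  rewrite /T (_ : cesaro M 0 = 0) ?mul0r ?coef0 //.
  by apply/polyP => l; rewrite coef_poly !coef0 mulr0 if_same.
have base : 8 <= Phi e p P q Q + eta.
  have h := opt e 0 1 0 1 (admissible01 R) (admissible01 R); apply: le_trans h.
  rewrite /Phi big1 ?add0r => [|j _]; last by rewrite !T0 addr0 mulr0.
  by rewrite coef1 cmod1; lra.
have hS := sumb e _ _ _ _ pP qQ.
have hP := P1 _ _ pP; have hQ := P1 _ _ qQ.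
exists p, q; split.
- by move=> z z1; apply/ltW/(admissible_lt1 pP).
- by move=> z z1; apply/ltW/(admissible_lt1 qQ).
move=> i0 i0n; pose i : 'I_n.+1 := Ordinal (i0n : (i0 < n.+1)%N).
have bi0 : 0 < b i0.
  rewrite lt_neqAle b0 // andbT eq_sym; apply/eqP => bi.
  have := bn _ i0n; rewrite bi expr0n /= leNgt invr_gt0 mulr_gt0 //.
have bi1 : b i0 <= 1.
  rewrite -(@ler_pXn2r _ 2) ?nnegrE ?b0 // expr1n; apply: le_trans b1.
  rewrite (bigD1 i) //= lerDl; apply: sumr_ge0 => j _; exact: sqr_ge0.
have main : b i ^+ 2 / (48 * 1152) - eta
    <= b i * (sgb (e i) * (complex.Re (T p i) + complex.Re (T q (n - i)%N))).
  case: (leqP i0 rho) => hi.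
    apply: (@bang_step n.+1 (fun j => b j) (fun j => complex.Re (T q (n - j)%N))
      (fun j p => complex.Re (T p j)) e p P eta i i0) => //.
    - by move=> j p' w; rewrite TD ReD.
    - by move=> j p' w; rewrite TB ReD ReN.
    - move=> e' p' P' pP'; have := opt e' p' P' q Q pP' qQ.
      by rewrite /Phi; lra.
    - by rewrite bi0.
    - by apply/andP; split=> //; lra.
    - by apply: Tu => //; case: pP.
  rewrite [complex.Re _ + _]addrC.
  apply: (@bang_step n.+1 (fun j => b j) (fun j => complex.Re (T p j))
      (fun j q => complex.Re (T q (n - j)%N)) e q Q eta i (n - i0)%N) => //.
  - by move=> j p' w; rewrite TD ReD.
  - by move=> j p' w; rewrite TB ReD ReN.
  - move=> e' q' Q' qQ'; have := opt e' p P q' Q' pP qQ'.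
    have swp e0 q0 : \sum_(j < n.+1) b j * sgb (e0 j) * (complex.Re (T q0 (n - j)%N) + complex.Re (T p j))
       = \sum_(j < n.+1) b j * sgb (e0 j) * (complex.Re (T p j) + complex.Re (T q0 (n - j)%N)).
      by apply: eq_bigr => j _; rewrite [complex.Re _ + _]addrC.
    by rewrite /Phi !swp; lra.
  - by rewrite bi0.
  - by apply/andP; split=> //; lra.
  - have hk : (n - i0 <= rho)%N by rewrite leq_subLR /n mul2n -addnn leq_add2r ltnW.
    have [u u1 uT] := Tu Q _ (e i) (proj1 qQ) hk.
    exists u; first exact: u1.
    exact: uT.
have etab : eta <= b i0 ^+ 2 / (96 * 1152).
  have k0 : 0 <= (96 * 1152)^-1 :> R by lra.
  exact: (ler_wpM2r k0 (bn _ i0n)).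
have main' : b i0 * (b i0 / (96 * 1152)) <= b i0 *
    (sgb (e i) * (complex.Re (T p i) + complex.Re (T q (n - i)%N))).
  by apply: le_trans main; rewrite /=; lra.
rewrite ler_pM2l // in main'.
apply: le_trans main' _; apply: le_trans (ler_norm _) _.
rewrite normrM norm_sgb mul1r.
have -> : complex.Re (T p i) + complex.Re (T q (n - i)%N)
    = complex.Re (T p i + (T q (n - i)%N)^*%C).
  by rewrite ReD; congr (_ + _); case: (T q _).
exact: Re_le_cmod.
Qed.

(** [W] is the sum of the [p] of the previous lemma and of the reversal of its [q],
    both with the factor [H]; hence it is dominated by [H], which is what
    [admissible_perturb] asks for when [H] is a companion. *)
Lemma block_polynomial : exists2 K : R, 0 < K &
  forall rho s H (a : nat -> R) (al : R), (2 * s <= rho)%N -> 0 <= al ->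
  (forall i, 0 <= a i) ->
  (size H <= s.+1)%N -> (forall z, cmod z = 1 -> cmod H.[z] <= 1) ->
  2^-1 <= cmod H`_0 -> \sum_(i < (2 * rho).+1) a i ^+ 2 <= al ^+ 2 ->
  exists W, [/\ (size W <= (2 * rho).+1)%N,
     forall z, cmod z = 1 -> cmod W.[z] <= K * al * cmod H.[z] &
     forall i, (i <= 2 * rho)%N -> a i <= cmod W`_i].
Proof.
have [k k0 kE] : exists2 k : R, 0 < k & k = 96 * 1152.
  by exists (96 * 1152); first lra.
exists (4 * k); first by rewrite mulr_gt0.
move=> rho s H a al s2 al0 a0 sH H1 H2 asum; set n := (2 * rho)%N in asum *.
have [al_eq0|al_neq0] := eqVneq al 0.
  exists 0; split; first by rewrite size_poly0.
    by move=> z z1; rewrite al_eq0 mulr0 mul0r horner0 cmod0.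
  move=> i ni; rewrite coef0 cmod0; move: asum; rewrite al_eq0 expr0n /=.
  rewrite (bigD1 (Ordinal (ni : (i < n.+1)%N))) //= => h.
  have : 0 <= \sum_(j < n.+1 | j != Ordinal (ni : (i < n.+1)%N)) a j ^+ 2.
    by apply: sumr_ge0 => j _; exact: sqr_ge0.
  by have := a0 i; nra.
have {al0 al_neq0} al0 : 0 < al by rewrite lt_neqAle eq_sym al_neq0.
have n0 : 0 < n.+1%:R :> R by rewrite ltr0n.
(* the constant term keeps every [b i] away from 0, as [bang_block] needs *)
pose b i := Num.sqrt (2^-1 * ((a i / al) ^+ 2 + n.+1%:R^-1)).
have bE i : b i ^+ 2 = 2^-1 * ((a i / al) ^+ 2 + n.+1%:R^-1).
  by rewrite sqr_sqrtr // mulr_ge0 // addr_ge0 ?sqr_ge0 ?invr_ge0 ?ltW.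
have [|||p [q [p1 q1 pq]]] := @bang_block rho s H b s2 H1 H2.
- by move=> i _; exact: sqrtr_ge0.
- by move=> i _; rewrite bE invfM ler_wpM2l // lerDr sqr_ge0.
- under eq_bigr do rewrite bE.
  rewrite -mulr_sumr big_split /= sumr_const card_ord -/n.
  under eq_bigr do rewrite expr_div_n.
  rewrite -mulr_suml -[_^-1 *+ _]mulr_natl divff ?gt_eqF //.
  have : (\sum_(i < n.+1) a i ^+ 2) / al ^+ 2 <= 1.
    by rewrite ler_pdivrMr ?mul1r // exprn_gt0.
  lra.
set M := (_ - s)%N in pq; set F := cesaro M p * H in pq *.
set G := cesaro M q * H in pq *.
have sz r : (size (cesaro M r * H)%R <= n.+1)%N.
  apply: leq_trans (size_polyMleq _ _) _.
  have sc : (size (cesaro M r) <= M)%N by apply: size_poly.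
  by have := leq_add sc sH; rewrite /M -/n; case: (_ + _)%N => //= l; lia.
pose W0 : {poly R[i]} := F + \poly_(i < n.+1) (G`_(n - i))^*%C.
have W0i i : (i <= n)%N -> W0`_i = F`_i + (G`_(n - i))^*%C.
  by move=> ni; rewrite coefD coef_poly ltnS ni.
have revE z : cmod z = 1 ->
    (\poly_(i < n.+1) (G`_(n - i))^*%C).[z] = z ^+ n * (G.[z])^*%C.
  move=> z1; rewrite horner_poly (horner_coef_wide _ (sz q)) rmorph_sum mulr_sumr.
  rewrite (reindex_inj rev_ord_inj) /=; apply: eq_bigr => i _.
  rewrite subSS subKn; last by rewrite -ltnS.
  rewrite rmorphM mulrCA; congr (_ * _).
  rewrite rmorphXn -{3}(subnK (_ : i <= n)%N); last by rewrite -ltnS.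
  by rewrite exprD -mulrA -exprMn circle_mulJ // expr1n mulr1.
have W0b z : cmod z = 1 -> cmod W0.[z] <= 2 * cmod H.[z].
  move=> z1; rewrite hornerD revE //; apply: le_trans (ler_cmodD _ _) _.
  rewrite cmodM cmodX z1 expr1n mul1r cmodJ !hornerM !cmodM -mulrDl.
  rewrite ler_wpM2r ?cmod_ge0 // -[leRHS](natrD _ 1 1).
  by apply: lerD; exact: cesaro_bound.
rewrite -kE in pq; pose c : R := al * (2 * k).
have c0 : 0 <= c by rewrite !mulr_ge0 // ltW.
exists (c%:C%C *: W0); split.
- apply: leq_trans (size_scale_leq _ _) _; apply: leq_trans (size_polyD _ _) _.
  by rewrite geq_max sz size_poly.
- move=> z z1; rewrite hornerZ cmodM cmod_real ger0_norm //.
  by have := ler_wpM2l c0 (W0b z z1); rewrite /c; lra.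
- move=> i ni; rewrite coefZ cmodM cmod_real ger0_norm // W0i //.
  apply: le_trans (ler_wpM2l c0 (pq i ni)).
  have : a i / al <= 2 * b i.
    rewrite -(@ler_pXn2r _ 2) // ?nnegrE ?mulr_ge0 ?sqrtr_ge0 ?invr_ge0 ?(ltW al0) //.
    rewrite [(2 * b i) ^+ 2]exprMn bE; have h2 := sqr_ge0 (a i / al).
    have h3 : 0 <= n.+1%:R^-1 :> R by rewrite invr_ge0 ltW.
    move: h2 h3; set x := (a i / al) ^+ 2; set y := _^-1; move=> h2 h3.
    have -> : 2 ^+ 2 * (2^-1 * (x + y)) = 2 * x + 2 * y by field.
    lra.
  rewrite ler_pdivrMr // => h; apply: (le_trans h).
  have kn0 : k != 0 by rewrite gt_eqF.
  have -> : c * (b i / k) = 2 * b i * al by rewrite /c; field.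
  by [].
Qed.

End Block.

(** * Sums over sparse blocks *)

Section Chain.
Variable R : realType.
Implicit Types (z : R[i]) (f p q w P Q G H W : {poly R[i]}).

Lemma dependent_sequence (T : Type) (Inv : nat -> T -> Prop)
    (Rel : nat -> T -> T -> Prop) (x0 : T) :
  Inv 0 x0 -> (forall j x, Inv j x -> exists2 y, Inv j.+1 y & Rel j x y) ->
  exists u, [/\ u 0 = x0, forall j, Inv j (u j) & forall j, Rel j (u j) (u j.+1)].
Proof.
move=> I0 step.
have /choice[g gP] : forall jx : nat * T, exists y,
    Inv jx.1 jx.2 -> Inv jx.1.+1 y /\ Rel jx.1 jx.2 y.
  move=> [j x] /=; have [/step[y]|nI] := pselect (Inv j x); first by exists y.
  by exists x0.
pose u := fix u j := if j is j'.+1 then g (j', u j') else x0.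
have Iu j : Inv j (u j) by elim: j => [//|j /(gP (j, u j))[]].
by exists u; split=> // j; have [] := gP (j, u j) (Iu j).
Qed.

(** Blocks are added one after the other. The next block lives at frequencies
    much larger than the degree of the companion of the current polynomial, so
    multiplication by this companion does not push the new frequencies out of
    the block. The sign with the larger companion is chosen, and so the companions
    stay bounded below at the origin as long as the squares of the sizes of the
    blocks are summable. *)
Lemma polynomial_chain : exists2 K : R, 0 < K &
  forall (lo rho : nat -> nat) (a : nat -> nat -> R) (beta : nat -> R),
  (forall j x, 0 <= a j x) -> (forall j, 0 <= beta j) ->
  (forall j, \sum_(i < j) beta i ^+ 2 <= 16^-1) -> (0 < lo 0)%N ->
  (forall j, lo j + 2 * rho j < lo j.+1)%N ->
  (forall j, 4 * (lo j + 2 * rho j) <= rho j.+1)%N ->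
  (forall j, K ^+ 2 * \sum_(i < (2 * rho j).+1) a j (lo j + i)%N ^+ 2 <= beta j ^+ 2) ->
  exists U : nat -> {poly R[i]}, [/\ U 0 = 0,
    forall j z, cmod z = 1 -> cmod (U j).[z] <= 1,
    forall j x, ~~ (lo j <= x <= lo j + 2 * rho j)%N -> (U j.+1)`_x = (U j)`_x &
    forall j x, (lo j <= x <= lo j + 2 * rho j)%N ->
      (U j)`_x = 0 /\ a j x <= cmod (U j.+1)`_x].
Proof.
have [K K0 block] := block_polynomial R; exists K => //.
move=> lo rho a beta a0 beta0 beta1 lo0 lo1 rho1 aK.
pose top j := (lo j + 2 * rho j)%N.
pose d j := if j is j'.+1 then top j' else 0%N.
have dlo j : (d j < lo j)%N by case: j => [//|j]; exact: lo1.
pose Inv j (x : {poly R[i]} * {poly R[i]}) :=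
  [/\ admissible x.1 x.2, (size x.1 <= (d j).+1)%N, (size x.2 <= (2 * d j).+1)%N &
      1 - 6 * \sum_(i < j) beta i ^+ 2 <= cmod x.2`_0].
pose Rel j (x y : {poly R[i]} * {poly R[i]}) :=
  (forall i, ~~ (lo j <= i <= top j)%N -> (y.1)`_i = (x.1)`_i) /\
  (forall i, (lo j <= i <= top j)%N -> (x.1)`_i = 0 /\ a j i <= cmod (y.1)`_i).
have I0 : Inv 0 (0, 1).
  split=> /=; [exact: admissible01 | by rewrite size_poly0 | by rewrite size_poly1 |].
  by rewrite big_ord0 coef1 cmod1; lra.
have step j x : Inv j x -> exists2 y, Inv j.+1 y & Rel j x y.
  case: x => f G [/= fG sf sG G0].
  have b4 : beta j <= 4^-1.
    rewrite -(@ler_pXn2r _ 2) ?nnegrE ?beta0 //.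
    have := beta1 j.+1; rewrite big_ord_recr /=.
    have : 0 <= \sum_(i < j) beta i ^+ 2 by apply: sumr_ge0 => i _; exact: sqr_ge0.
    lra.
  have ds : (2 * (2 * d j) <= rho j)%N.
    by case: (j) => [//|j']; rewrite mulnA; exact: rho1.
  have [||||||W [sW WG Wa]] := block (rho j) (2 * d j)%N G
      (fun i => a j (lo j + i)%N) (beta j / K) ds.
  - by rewrite divr_ge0 // ltW.
  - by move=> i; exact: a0.
  - by [].
  - by move=> z z1; exact: (admissible_le1 fG).
  - by have := beta1 j; lra.
  - by rewrite expr_div_n ler_pdivlMr ?exprn_gt0 // mulrC.
  pose w := 'X^(lo j) * W.
  have wG z : cmod z = 1 -> cmod w.[z] <= beta j * cmod G.[z].
    move=> z1; rewrite hornerM hornerXn cmodM cmodX z1 expr1n mul1r.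
    by apply: le_trans (WG z z1) _; rewrite mulrCA divff ?gt_eqF // mulr1.
  have sw : (size w <= (top j).+1)%N.
    apply: leq_trans (size_polyMleq _ _) _; rewrite size_polyXn addSn /=.
    by rewrite /top -addnS leq_add2l.
  have sf' : (size f <= (top j).+1)%N.
    apply: leq_trans sf _; rewrite ltnS /top.
    by apply: leq_trans (ltnW (dlo j)) _; exact: leq_addr.
  have [|Gp [Gm [pGp pGm sGp sGm GpGm]]] := admissible_perturb fG _ wG sf' sw.
    by rewrite beta0.
  have sp : (size (f + w)%R <= (top j).+1)%N.
    by apply: leq_trans (size_polyD _ _) _; rewrite geq_max sf' sw.
  have sm : (size (f - w)%R <= (top j).+1)%N.
    by apply: leq_trans (size_polyD _ _) _; rewrite geq_max size_polyN sf' sw.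
  have fi i : (lo j <= i)%N -> f`_i = 0.
    by move=> li; rewrite nth_default // (leq_trans sf) // (leq_trans (dlo j)).
  have wi i : w`_i = if (i < lo j)%N then 0 else W`_(i - lo j) by rewrite coefXnM.
  have w0 i : ~~ (lo j <= i <= top j)%N -> w`_i = 0.
    rewrite wi; case: ltnP => //= li; rewrite -ltnNge => ti.
    by rewrite nth_default // (leq_trans sW) // leq_subRL // addnC -ltnS /top;
       move: ti; rewrite /top; lia.
  have wa i : (lo j <= i <= top j)%N -> a j i <= cmod w`_i.
    move=> /andP[li ti]; rewrite wi ltnNge li /=.
    rewrite -{1}(subnKC li); apply: Wa.
    by rewrite leq_subLR.
  set S := \sum_(i < j) _ in G0.
  have S0 : 0 <= S by apply: sumr_ge0 => i _; exact: sqr_ge0.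
  have S1 : S <= 16^-1 by exact: beta1.
  have b2 : beta j ^+ 2 <= 16^-1.
    by have := ler_pM (beta0 j) (beta0 j) b4 b4; rewrite -expr2; lra.
  have b20 := sqr_ge0 (beta j).
  have grow (x y : R) : 0 <= x -> 0 <= y ->
      (1 - 6 * beta j ^+ 2) * cmod G`_0 ^+ 2 <= x * y -> x < y ->
      1 - 6 * (S + beta j ^+ 2) <= y.
    move=> x0 y0 hxy xy; set g := cmod G`_0 in G0 hxy; set b := beta j ^+ 2 in b2 b20 hxy *.
    apply: (@le_trans _ _ ((1 - 6 * b) * g)); first by nra.
    rewrite -(@ler_pXn2r _ 2) ?nnegrE //; last by rewrite mulr_ge0 ?cmod_ge0 //; lra.
    apply: (@le_trans _ _ ((1 - 6 * b) * g ^+ 2)); last by nra.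
    by rewrite exprMn ler_wpM2r ?sqr_ge0 // expr2 ler_piMr //; lra.
  have [h|h] := ltP (cmod Gp`_0) (cmod Gm`_0).
    exists (f - w, Gm); split=> //=.
    - rewrite big_ord_recr /=; apply: grow GpGm h; exact: cmod_ge0.
    - by move=> i hi; rewrite coefB w0 // subr0.
    - move=> i hi; have /andP[li _] := hi.
      by rewrite coefB fi // sub0r cmodN; split=> //; exact: wa.
  exists (f + w, Gp); split=> //=.
  - rewrite big_ord_recr /= -/S; move: h; rewrite le_eqVlt => /orP[/eqP h|h]; last first.
      rewrite [X in _ <= X]mulrC in GpGm.
      exact: (grow _ _ (cmod_ge0 _) (cmod_ge0 _) GpGm h).
    move: GpGm; rewrite h -expr2 => GpGm; set g := cmod G`_0 in G0 GpGm.
    set b := beta j ^+ 2 in b2 b20 GpGm *.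
    apply: (@le_trans _ _ ((1 - 6 * b) * g)); first by nra.
    rewrite -(@ler_pXn2r _ 2) ?nnegrE ?cmod_ge0 //; last first.
      by rewrite mulr_ge0 ?cmod_ge0 //; lra.
    apply: le_trans GpGm.
    by rewrite exprMn ler_wpM2r ?sqr_ge0 // expr2 ler_piMr //; lra.
  - by move=> i hi; rewrite coefD w0 // addr0.
  - move=> i hi; have /andP[li _] := hi.
    by rewrite coefD fi // add0r; split=> //; exact: wa.
have [u [u0 Iu Ru]] := dependent_sequence I0 step.
exists (fun j => (u j).1); split.
- by rewrite u0.
- by move=> j z z1; have [uA _ _ _] := Iu j; apply/ltW/(admissible_lt1 uA).
- by move=> j x; have [h _] := Ru j; exact: h.
- by move=> j x; have [_ h] := Ru j; exact: h.
Qed.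

(** The terms of a convergent series divided by the square roots of its tails are
    dominated by a telescoping series; as the squares of the weights are wanted,
    these are the fourth roots of the tails. *)
Lemma summable_weights (t : nat -> R) (T : R) : (forall j, 0 < t j) ->
  (forall j, \sum_(i < j) t i <= T) ->
  exists d : nat -> R, exists B : R, [/\ forall j, 0 < d j,
    forall j, d j.+1 <= d j, d @ \oo --> (0 : R) &
    forall j, \sum_(i < j) t i / d i ^+ 2 <= B].
Proof.
move=> t0 tT; pose s j := \sum_(i < j) t i.
have sS j : s j.+1 = s j + t j by rewrite /s big_ord_recr.
have s_nd : {homo s : m n / (m <= n)%N >-> m <= n}.
  by apply/nondecreasing_seqP => n; rewrite sS lerDl ltW.
have cs : cvgn s.
  by apply: nondecreasing_is_cvgn => //; exists T => _ [n _ <-]; exact: tT.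
pose L := limn s; have sL j : s j < L.
  apply: (@lt_le_trans _ _ (s j.+1)); first by rewrite sS ltrDl.
  exact: nondecreasing_cvgn_le.
pose r j := Num.sqrt (L - s j).
have r0 j : 0 < r j by rewrite sqrtr_gt0 subr_gt0.
have r2 j : r j ^+ 2 = L - s j by rewrite sqr_sqrtr // subr_ge0 ltW.
have rS j : r j.+1 <= r j by rewrite ler_wsqrtr // lerD2l lerN2 s_nd.
have cr : r @ \oo --> (0 : R).
  have h : (fun j => L - s j) @ \oo --> L - L.
    by apply: cvgB; [exact: cvg_cst | exact: cs].
  rewrite subrr in h; rewrite -(@sqrtr0 R).
  by apply: continuous_cvg h; exact: sqrt_continuous.
have cd : (fun j => Num.sqrt (r j)) @ \oo --> (0 : R).
  by rewrite -(@sqrtr0 R); apply: continuous_cvg cr; exact: sqrt_continuous.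
exists (fun j => Num.sqrt (r j)), (2 * r 0); split=> //.
- by move=> j; rewrite sqrtr_gt0.
- by move=> j; rewrite ler_wsqrtr.
- move=> j; apply: (@le_trans _ _ (2 * r 0 - 2 * r j)); last first.
    by have := r0 j; lra.
  elim: j => [|j IH]; first by rewrite big_ord0 subrr.
  rewrite big_ord_recr /= sqr_sqrtr ?(ltW (r0 j)) //.
  have : t j / r j <= 2 * r j - 2 * r j.+1.
    rewrite ler_pdivrMr //.
    have -> : t j = r j ^+ 2 - r j.+1 ^+ 2 by rewrite !r2 sS; ring.
    by have := rS j; have := r0 j; have := r0 j.+1; nra.
  lra.
Qed.

End Chain.

(** * Integrals and Fourier coefficients on the circle *)

Section CircleIntegral.
Variable R : realType.
Implicit Types (g h : R -> R) (f : R -> R[i]).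

Definition ccont g := {within circle R, continuous g}.

Local Notation mean g := (\int[lebesgue_measure]_(t in circle R) g t)%R.

Lemma ccontT g : continuous g -> ccont g.
Proof. exact: continuous_subspaceT. Qed.

Lemma ccontD g h : ccont g -> ccont h -> ccont (fun t => g t + h t).
Proof. by move=> cg ch x; apply: cvgD; [exact: cg | exact: ch]. Qed.

Lemma ccontB g h : ccont g -> ccont h -> ccont (fun t => g t - h t).
Proof. by move=> cg ch x; apply: cvgB; [exact: cg | exact: ch]. Qed.

Lemma ccontM g h : ccont g -> ccont h -> ccont (fun t => g t * h t).
Proof. by move=> cg ch x; apply: cvgM; [exact: cg | exact: ch]. Qed.

Lemma ccont_cst (c : R) : ccont (fun=> c).
Proof. by apply: ccontT => x; exact: cvg_cst. Qed.

Lemma measurable_circle : measurable (circle R : set (measurableTypeR R)).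
Proof. exact: measurable_itv. Qed.

Lemma circle_integrable g : ccont g ->
  lebesgue_measure.-integrable (circle R) (EFin \o g).
Proof.
move=> cg; apply: continuous_compact_integrable => //; exact: segment_compact.
Qed.

Lemma meanD g h : ccont g -> ccont h -> mean (fun t => g t + h t) = mean g + mean h.
Proof.
move=> cg ch; apply: RintegralD; [exact: measurable_circle| |];
  exact: circle_integrable.
Qed.

Lemma meanB g h : ccont g -> ccont h -> mean (fun t => g t - h t) = mean g - mean h.
Proof.
move=> cg ch; apply: RintegralB; [exact: measurable_circle| |];
  exact: circle_integrable.
Qed.

Lemma meanZ (c : R) g : ccont g -> mean (fun t => c * g t) = c * mean g.
Proof.
move=> cg; apply: RintegralZl; [exact: measurable_circle|exact: circle_integrable].
Qed.

Lemma ler_mean g h : ccont g -> ccont h ->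
  (forall t, circle R t -> g t <= h t) -> mean g <= mean h.
Proof.
move=> cg ch gh; apply: le_Rintegral => //; [exact: measurable_circle| |];
  exact: circle_integrable.
Qed.

Lemma mean_cst (c : R) : mean (fun=> c) = c.
Proof.
rewrite Rintegral_cst; last exact: measurable_circle.
transitivity (c * fine (1%:E : \bar R)); last by rewrite /= mulr1.
congr (_ * fine _).
apply: etrans (@lebesgue_measure_itv R `[- 2^-1, 2^-1]) _.
rewrite /= lte_fin ifT; last by lra.
by rewrite -EFinD; congr EFin; lra.
Qed.

Lemma mean_FTC g (G : R -> R) : continuous g -> (forall t : R, is_derive t 1 G (g t)) ->
  mean g = G 2^-1 - G (- 2^-1).
Proof.
move=> cg dG; rewrite /Rintegral (@continuous_FTC2 _ g G) //.
- lra.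
- exact: ccontT.
- have cG x : {for x, continuous G}.
    apply: differentiable_continuous; apply/derivable1_diffP.
    exact: ex_derive.
  split.
  + by move=> x _; exact: ex_derive.
  + by apply: cvg_at_right_filter; exact: cG.
  + by apply: cvg_at_left_filter; exact: cG.
- by move=> x _; rewrite derive1E; exact: derive_val.
Qed.

Lemma sin_pi_int (n : int) : sin (pi * n%:~R) = 0 :> R.
Proof.
have H (m : nat) : sin (pi * m%:R) = 0 :> R.
  elim: m => [|m IH]; first by rewrite mulr0 sin0.
  by rewrite -natr1 mulrDr mulr1 sinDpi IH oppr0.
case: n => m; first exact: H.
by rewrite NegzE mulrNz mulrN sinN -pmulrn H oppr0.
Qed.

Lemma continuous_cosM (c : R) : continuous (fun t : R => cos (c * t)).
Proof.
move=> x; apply: continuous_comp; last exact: continuous_cos.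
by apply: continuousM; [exact: cst_continuous | exact: cvg_id].
Qed.

Lemma continuous_sinM (c : R) : continuous (fun t : R => sin (c * t)).
Proof.
move=> x; apply: continuous_comp; last exact: continuous_sin.
by apply: continuousM; [exact: cst_continuous | exact: cvg_id].
Qed.

Lemma mean_cosM (n : int) : n != 0 -> mean (fun t => cos (2 * pi * n%:~R * t)) = 0.
Proof.
move=> n0; set c : R := 2 * pi * n%:~R.
have c0 : c != 0 by rewrite mulf_neq0 ?intr_eq0 // mulf_neq0 ?pnatr_eq0 // gt_eqF ?pi_gt0.
have dG (t : R) : is_derive t 1 (fun t => c^-1 * sin (c * t)) (cos (c * t)).
  apply: is_derive_eq; by rewrite /GRing.scale /=; field.
rewrite (mean_FTC (@continuous_cosM c) dG).
have -> : c * 2^-1 = pi * n%:~R by rewrite /c; field.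
have -> : c * - 2^-1 = - (pi * n%:~R) by rewrite /c; field.
by rewrite sinN sin_pi_int oppr0 subrr.
Qed.

Lemma mean_sinM (n : int) : mean (fun t => sin (2 * pi * n%:~R * t)) = 0.
Proof.
have [->|n0] := eqVneq n 0.
  under eq_Rintegral do rewrite mulr0z mulr0 mul0r sin0.
  exact: mean_cst.
set c : R := 2 * pi * n%:~R.
have c0 : c != 0 by rewrite mulf_neq0 ?intr_eq0 // mulf_neq0 ?pnatr_eq0 // gt_eqF ?pi_gt0.
have dG (t : R) : is_derive t 1 (fun t => - c^-1 * cos (c * t)) (sin (c * t)).
  apply: is_derive_eq; by rewrite /GRing.scale /=; field.
rewrite (mean_FTC (@continuous_sinM c) dG).
by rewrite mulrN cosN subrr.
Qed.

Definition ccontc f :=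
  ccont (fun t => complex.Re (f t)) /\ ccont (fun t => complex.Im (f t)).

Lemma ReM (z w : R[i]) : complex.Re (z * w) =
  complex.Re z * complex.Re w - complex.Im z * complex.Im w.
Proof. by case: z w => [a b] [c d]. Qed.

Lemma ImM (z w : R[i]) : complex.Im (z * w) =
  complex.Re z * complex.Im w + complex.Im z * complex.Re w.
Proof. by case: z w => [a b] [c d]. Qed.

Lemma complex_eqP (z w : R[i]) : complex.Re z = complex.Re w ->
  complex.Im z = complex.Im w -> z = w.
Proof. by case: z w => [a b] [c d] /= -> ->. Qed.

Lemma ccontcD f1 f2 : ccontc f1 -> ccontc f2 -> ccontc (fun t => f1 t + f2 t).
Proof.
move=> [a b] [c d]; split.
  by under [X in ccont X]funext do rewrite ReD; exact: ccontD.
by under [X in ccont X]funext do rewrite ImD; exact: ccontD.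
Qed.

Lemma ccontcM f1 f2 : ccontc f1 -> ccontc f2 -> ccontc (fun t => f1 t * f2 t).
Proof.
move=> [a b] [c d]; split.
  by under [X in ccont X]funext do rewrite ReM; apply: ccontB; exact: ccontM.
by under [X in ccont X]funext do rewrite ImM; apply: ccontD; exact: ccontM.
Qed.

Lemma ccontc_cst (c : R[i]) : ccontc (fun=> c).
Proof. by split; exact: ccont_cst. Qed.

Lemma ccontc_sum (I : Type) (s : seq I) (F : I -> R -> R[i]) :
  (forall i, ccontc (F i)) -> ccontc (fun t => \sum_(i <- s) F i t).
Proof.
move=> cF; elim: s => [|i s IH].
  by under [X in ccontc X]funext do rewrite big_nil; exact: ccontc_cst.
by under [X in ccontc X]funext do rewrite big_cons; exact: ccontcD.
Qed.

Lemma circle_integralD f1 f2 : ccontc f1 -> ccontc f2 ->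
  circle_integral (fun t => f1 t + f2 t) = circle_integral f1 + circle_integral f2.
Proof.
move=> [a b] [c d]; apply: complex_eqP; rewrite ?ReD ?ImD /=.
  by rewrite -meanD //; under [in LHS]eq_Rintegral do rewrite ReD.
by rewrite -meanD //; under [in LHS]eq_Rintegral do rewrite ImD.
Qed.

Lemma circle_integralZ (c : R[i]) f : ccontc f ->
  circle_integral (fun t => c * f t) = c * circle_integral f.
Proof.
move=> [a b]; apply: complex_eqP; rewrite ?ReM ?ImM /=.
  under eq_Rintegral do rewrite ReM.
  by rewrite meanB ?meanZ //; apply: ccontM => //; exact: ccont_cst.
under eq_Rintegral do rewrite ImM.
by rewrite meanD ?meanZ //; apply: ccontM => //; exact: ccont_cst.
Qed.

Lemma circle_integral_cst (c : R[i]) : circle_integral (fun=> c) = c.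
Proof. by apply: complex_eqP => /=; exact: mean_cst. Qed.

Lemma circle_integral_sum (I : Type) (s : seq I) (F : I -> R -> R[i]) :
  (forall i, ccontc (F i)) ->
  circle_integral (fun t => \sum_(i <- s) F i t)
    = \sum_(i <- s) circle_integral (F i).
Proof.
move=> cF; elim: s => [|i s IH].
  rewrite big_nil -[RHS](circle_integral_cst 0); congr circle_integral.
  by apply/funext => t; rewrite big_nil.
rewrite big_cons -IH -circle_integralD //; last exact: ccontc_sum.
by congr circle_integral; apply/funext => t; rewrite big_cons.
Qed.

Lemma expiD (x y : R) : expi (x + y) = expi x * expi y.
Proof.
apply: complex_eqP; rewrite ?ReM ?ImM /=; first by rewrite cosD.
by rewrite sinD addrC.
Qed.

Lemma expi0 : expi 0 = 1 :> R[i].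
Proof. by rewrite /expi cos0 sin0. Qed.

Lemma cmod_expi (x : R) : cmod (expi x) = 1.
Proof. by rewrite cmodE /= cos2Dsin2 sqrtr1. Qed.

Lemma expiX (x : R) n : expi x ^+ n = expi (x * n%:R).
Proof.
elim: n => [|n IH]; first by rewrite mulr0 expi0.
by rewrite exprS IH -expiD -natr1 mulrDr mulr1 addrC.
Qed.

Lemma expiN (x : R) : expi (- x) = (expi x)^*%C.
Proof. by rewrite /expi cosN sinN. Qed.

Definition wave (n : int) (t : R) : R[i] := expi (2 * pi * n%:~R * t).

Lemma waveD m n t : wave (m + n) t = wave m t * wave n t.
Proof. by rewrite /wave rmorphD mulrDr mulrDl expiD. Qed.

Lemma ccontc_wave n : ccontc (wave n).
Proof.
by split; apply: ccontT; [exact: continuous_cosM | exact: continuous_sinM].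
Qed.

Lemma circle_integral_wave n : circle_integral (wave n) = (n == 0)%:R.
Proof.
have [->|n0] := eqVneq n 0.
  rewrite -[RHS]circle_integral_cst; congr circle_integral; apply/funext => t.
  by rewrite /wave mulr0z mulr0 mul0r expi0.
apply: complex_eqP => /=; first exact: mean_cosM.
exact: mean_sinM.
Qed.

Lemma fourier_coefE f n :
  fourier_coef f n = circle_integral (fun t => f t * wave (- n) t).
Proof.
rewrite /fourier_coef; congr circle_integral; apply/funext => t.
by rewrite /wave mulrNz mulrN mulNr.
Qed.

Lemma fourier_coef_wave m n : fourier_coef (wave m) n = (m == n)%:R.
Proof.
rewrite fourier_coefE -[m == n]subr_eq0 -circle_integral_wave.
by congr circle_integral; apply/funext => t; rewrite -waveD.
Qed.

Lemma fourier_coefZ (c : R[i]) f n : ccontc f ->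
  fourier_coef (fun t => c * f t) n = c * fourier_coef f n.
Proof.
move=> cf; rewrite !fourier_coefE -circle_integralZ; last first.
  by apply: ccontcM => //; exact: ccontc_wave.
by congr circle_integral; apply/funext => t; rewrite mulrA.
Qed.

Lemma fourier_coef_sum (I : Type) (s : seq I) (F : I -> R -> R[i]) n :
  (forall i, ccontc (F i)) ->
  fourier_coef (fun t => \sum_(i <- s) F i t) n
    = \sum_(i <- s) fourier_coef (F i) n.
Proof.
move=> cF; rewrite fourier_coefE.
under [RHS]eq_bigr do rewrite fourier_coefE.
rewrite -circle_integral_sum => [|i]; last first.
  by apply: ccontcM => //; exact: ccontc_wave.
by congr circle_integral; apply/funext => t; rewrite mulr_suml.
Qed.

Lemma waveX (m : nat) t : wave 1 t ^+ m = wave m t.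
Proof. by rewrite /wave expiX mulr1 mulrAC -pmulrn. Qed.

Lemma horner_waveE (P : {poly R[i]}) :
  (fun t => P.[wave 1 t]) = (fun t => \sum_(i < size P) P`_i * wave i t).
Proof.
apply/funext => t; rewrite horner_coef.
by apply: eq_bigr => i _; rewrite waveX.
Qed.

Lemma ccontc_horner_wave (P : {poly R[i]}) : ccontc (fun t => P.[wave 1 t]).
Proof.
rewrite horner_waveE; apply: ccontc_sum => i.
by apply: ccontcM; [exact: ccontc_cst | exact: ccontc_wave].
Qed.

Lemma fourier_coef_trig_poly (P : {poly R[i]}) (n : int) :
  fourier_coef (fun t => P.[wave 1 t]) n = if n is Posz m then P`_m else 0.
Proof.
rewrite horner_waveE fourier_coef_sum => [|i]; last first.
  by apply: ccontcM; [exact: ccontc_cst | exact: ccontc_wave].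
have coefE (i : 'I_(size P)) :
    fourier_coef (fun t => P`_i * wave i t) n = P`_i * (i%:Z == n)%:R.
  by rewrite fourier_coefZ ?fourier_coef_wave //; exact: ccontc_wave.
under eq_bigr do rewrite coefE.
case: n coefE => n _; last by rewrite big1 // => i _; rewrite mulr0.
have [nP|nP] := ltnP n (size P); last first.
  rewrite big1 ?nth_default // => i _.
  by rewrite eqz_nat ltn_eqF ?mulr0 // (leq_trans (ltn_ord i)).
rewrite (bigD1 (Ordinal nP)) //= eqxx mulr1 big1 ?addr0 // => i ni.
by move: ni; rewrite -val_eqE eqz_nat /= => /negPf ->; rewrite mulr0.
Qed.

Lemma fourier_coef_le f n (e : R) : ccontc f ->
  (forall t, circle R t -> cmod (f t) <= e) ->
  `|complex.Re (fourier_coef f n)| <= e /\ `|complex.Im (fourier_coef f n)| <= e.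
Proof.
move=> cf fe; have [cR cI] := ccontcM cf (ccontc_wave (- n)).
have bnd t : circle R t -> cmod (f t * wave (- n) t) <= e.
  by move=> /fe; rewrite cmodM cmod_expi mulr1.
have bd g : ccont g -> (forall t, circle R t -> `|g t| <= e) -> `|mean g| <= e.
  move=> cg ge; rewrite ler_norml; apply/andP; split.
    rewrite -(mean_cst (- e)); apply: ler_mean => //; first exact: ccont_cst.
    by move=> t /ge; rewrite ler_norml => /andP[].
  rewrite -[leRHS]mean_cst; apply: ler_mean => //; first exact: ccont_cst.
  by move=> t /ge; rewrite ler_norml => /andP[].
rewrite fourier_coefE; split; apply: bd => // t /bnd; apply: le_trans.
  exact: Re_le_cmod.
exact: Im_le_cmod.
Qed.

Lemma within_continuous_Re_Im (A : set R) f :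
  {within A, continuous (f : R -> (R[i])^o)} <->
  {within A, continuous (fun t => complex.Re (f t))} /\
  {within A, continuous (fun t => complex.Im (f t))}.
Proof.
split=> [cf|[cR cI] x].
  have e0C (e : R) : 0 < e -> 0 < e%:C%C by move=> e0; rewrite ltcR.
  split=> x; apply/cvgrPdist_lt => e e0;
    have /cvgrPdist_lt/(_ _ (e0C _ e0)) := cf x; apply: filterS => t;
    rewrite [`|_ : R[i]^o|]normc_cmod ltcR; apply: le_lt_trans.
    by rewrite -ReN -ReD; exact: Re_le_cmod.
  by rewrite -ImN -ImD; exact: Im_le_cmod.
apply/cvgrPdist_lt => e e0.
have [e' e'0 eE] : exists2 e' : R, 0 < e' & e = e'%:C%C.
  exists (complex.Re e); first by move: e0; rewrite ltcE => /andP[].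
  by move: e0; rewrite ltcE /= => /andP[/eqP h _]; case: e h => a b /= ->.
have e2 : 0 < e' / 2 by rewrite divr_gt0.
have /cvgrPdist_lt/(_ _ e2) hR := cR x.
have /cvgrPdist_lt/(_ _ e2) hI := cI x.
apply: filterS2 hR hI => t hR hI.
rewrite eE [`|_ : R[i]^o|]normc_cmod ltcR.
apply: le_lt_trans (cmod_le_ReIm _) _.
rewrite !ReD !ImD !ReN !ImN; lra.
Qed.

End CircleIntegral.

(** * Continuous functions with spectrum in sparse blocks *)

Section Series.
Variable R : realType.

Lemma telescoping_series_bound (u d : nat -> R) :
  (forall j, `|u j| <= d j - d j.+1) -> d @ \oo --> (0 : R) ->
  cvgn (series u) /\ forall n, `|limn (series u) - series u n| <= d n.
Proof.
move=> ud d0.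
have tele m n : (m <= n)%N -> \sum_(m <= j < n) `|u j| <= d m - d n.
  move=> mn; rewrite -(subnK mn) addnC; elim: (n - m)%N => [|k IH].
    by rewrite addn0 big_geq // subrr.
  rewrite addnS big_nat_recr ?leq_addr //=; have := ud (m + k)%N; lra.
have ddec : {homo d : m n / (m <= n)%N >-> n <= m}.
  by apply/nonincreasing_seqP => n; have := ud n; have := normr_ge0 (u n); lra.
have dge n : 0 <= d n.
  rewrite -(cvg_lim _ d0) //; apply: limr_le; first by apply/cvg_ex; exists 0.
  by exists n => // m /= nm; exact: ddec.
have cs : cvgn (series u).
  apply: normed_cvg; apply: nondecreasing_is_cvgn.
    apply/nondecreasing_seqP => n /=; rewrite !seriesEnat /= big_nat_recr //= lerDl.
    exact: normr_ge0.
  exists (d 0) => _ [n _ <-] /=; rewrite seriesEnat /=.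
  by apply: le_trans (tele _ _ _) _ => //; have := dge n; lra.
split=> // n.
have cv : (fun m => `|series u m - series u n|) @ \oo -->
    `|limn (series u) - series u n|.
  by apply: cvg_norm; apply: cvgB; [exact: cs | exact: cvg_cst].
rewrite -(cvg_lim _ cv) //; apply: limr_le; first by apply/cvg_ex; eexists; exact: cv.
exists n => // m /= nm.
have -> : series u m - series u n = \sum_(n <= j < m) u j by rewrite sub_series_geq.
apply: le_trans (ler_norm_sum _ _ _) _; apply: le_trans (tele _ _ nm) _.
by have := dge m; lra.
Qed.

Lemma ccont_uniform_limit (g : R -> R) (s : nat -> R -> R) (d : nat -> R) :
  (forall n, ccont (s n)) -> d @ \oo --> (0 : R) ->
  (forall n t, `|g t - s n t| <= d n) -> ccont g.
Proof.
move=> cs d0 gs x; apply/cvgrPdist_lt => e e0.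
have e3 : 0 < e / 3 by rewrite divr_gt0.
have /cvgrPdist_lt/(_ _ e3)[n _ /(_ n (leqnn n))] := d0.
rewrite sub0r normrN => dn.
have /cvgrPdist_lt/(_ _ e3) := cs n x; apply: filterS => t st.
have hx : `|g x - s n x| <= d n := gs n x.
have ht : `|s n t - g t| <= d n by rewrite distrC.
have dn' := ler_norm (d n).
have -> : g x - g t = (g x - s n x) + (s n x - s n t) + (s n t - g t) by ring.
have h1 := ler_normD (g x - s n x + (s n x - s n t)) (s n t - g t).
have h2 := ler_normD (g x - s n x) (s n x - s n t).
have h3 : `|s n x - s n t| < e / 3 by exact: st.
lra.
Qed.

Lemma wave_endpoints : wave 1 (- 2^-1) = wave 1 2^-1 :> R[i].
Proof.
rewrite /wave mulr1.
have -> : 2 * pi * - 2^-1 = - pi :> R by field.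
have -> : 2 * pi * 2^-1 = pi :> R by field.
by rewrite /expi cosN sinN sinpi oppr0.
Qed.

(** Summation by parts: bounded partial sums [U j] with weights decreasing to
    zero give a uniformly convergent series. *)
Lemma weighted_trig_series (U : nat -> {poly R[i]}) (d : nat -> R) :
  (forall j z, cmod z = 1 -> cmod (U j).[z] <= 1) ->
  (forall j, d j.+1 <= d j) -> d @ \oo --> (0 : R) ->
  exists f : R -> R[i], [/\ ccontc f, f (- 2^-1) = f 2^-1 &
    forall (n : int) j0 v,
      (forall j, (j < j0)%N -> fourier_coef (fun t => (U j).[wave 1 t]) n = 0) ->
      (forall j, (j0 <= j)%N -> fourier_coef (fun t => (U j).[wave 1 t]) n = v) ->
      fourier_coef f n = (d j0)%:C%C * v].
Proof.
move=> U1 ddec d0.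
pose c j := d j - d j.+1.
have c0 j : 0 <= c j by rewrite subr_ge0.
pose F j t := (c j)%:C%C * (U j).[wave 1 t].
have Fc j t : cmod (F j t) <= c j.
  rewrite cmodM cmod_real ger0_norm // -[leRHS]mulr1 ler_wpM2l //.
  by apply: U1; exact: cmod_expi.
pose f t : R[i] := Complex (limn (series (fun j => complex.Re (F j t))))
                           (limn (series (fun j => complex.Im (F j t)))).
have hR t := @telescoping_series_bound (fun j => complex.Re (F j t)) d
  (fun j => le_trans (Re_le_cmod _) (Fc j t)) d0.
have hI t := @telescoping_series_bound (fun j => complex.Im (F j t)) d
  (fun j => le_trans (Im_le_cmod _) (Fc j t)) d0.
pose S n t := \sum_(j < n) F j t.
have SR n t : complex.Re (S n t) = series (fun j => complex.Re (F j t)) n.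
  by rewrite Re_sum seriesEord.
have SI n t : complex.Im (S n t) = series (fun j => complex.Im (F j t)) n.
  by rewrite Im_sum seriesEord.
have cF j : ccontc (F j).
  by apply: ccontcM; [exact: ccontc_cst | exact: ccontc_horner_wave].
have cS n : ccontc (S n) by apply: ccontc_sum => j; exact: cF.
have cf : ccontc f.
  split.
    apply: (@ccont_uniform_limit _ (fun n t => complex.Re (S n t)) d) => //.
      by move=> n; have [] := cS n.
    by move=> n t; rewrite SR; have [_] := hR t; exact.
  apply: (@ccont_uniform_limit _ (fun n t => complex.Im (S n t)) d) => //.
    by move=> n; have [] := cS n.
  by move=> n t; rewrite SI; have [_] := hI t; exact.
exists f; split=> //.
  have e j : F j (- 2^-1) = F j 2^-1 by rewrite /F wave_endpoints.
  by rewrite /f; congr Complex; congr (limn (series _)); apply/funext => j;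
     rewrite e.
move=> n j0 v U0 Uv.
have coefS N : (j0 <= N)%N ->
    fourier_coef (S N) n = (d j0 - d N)%:C%C * v.
  move=> jN; rewrite fourier_coef_sum //.
  have coefF j : fourier_coef (F j) n =
      (c j)%:C%C * fourier_coef (fun t => (U j).[wave 1 t]) n.
    by rewrite fourier_coefZ //; exact: ccontc_horner_wave.
  rewrite -(big_mkord xpredT (fun j => fourier_coef (F j) n)).
  rewrite (big_cat_nat (n := j0)) //= big_nat big1 ?add0r; last first.
    by move=> j /andP[_ jj]; rewrite coefF U0 ?mulr0.
  rewrite -(subnK jN) addnC; elim: (N - j0)%N => [|k IH].
    by rewrite addn0 big_geq // subrr mul0r.
  rewrite addnS big_nat_recr ?leq_addr //= IH coefF Uv ?leq_addr // -mulrDl.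
  by rewrite -rmorphD; congr (_ %:C%C * _); rewrite /c; ring.
have cB N : ccontc (fun t => f t + (-1) * S N t).
  by apply: ccontcD => //; apply: ccontcM => //; exact: ccontc_cst.
have coefB N : (j0 <= N)%N -> fourier_coef (fun t => f t + (-1) * S N t) n
     = fourier_coef f n - (d j0)%:C%C * v + (d N)%:C%C * v.
  move=> jN; rewrite fourier_coefE.
  under [X in circle_integral X]funext do rewrite mulrDl -mulrA.
  rewrite circle_integralD ?circle_integralZ; try by
    do ?[exact: ccontc_cst | exact: ccontc_wave | exact: cf | exact: cS | apply: ccontcM].
  by rewrite -!fourier_coefE coefS // rmorphB /=; ring.
pose x := fourier_coef f n - (d j0)%:C%C * v.
have xb N : (j0 <= N)%N -> cmod x <= d N * (4 + cmod v).
  move=> jN; have [|a b] := @fourier_coef_le R _ n (2 * d N) (cB N).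
    move=> t _; apply: le_trans (cmod_le_ReIm _) _.
    have [_ /(_ N) a] := hR t; have [_ /(_ N) b] := hI t.
    rewrite mulN1r !ReD !ImD ReN ImN SR SI /=; lra.
  rewrite coefB // -/x in a b.
  have dN : 0 <= d N.
    by have [_ /(_ N)] := hR 0; apply: le_trans; exact: normr_ge0.
  have -> : x = x + (d N)%:C%C * v + - ((d N)%:C%C * v) by rewrite addrK.
  apply: le_trans (ler_cmodD _ _) _; rewrite cmodN cmodM cmod_real ger0_norm //.
  have := cmod_le_ReIm (x + (d N)%:C%C * v); lra.
have x0 : cmod x <= 0.
  have cv : (fun N => d N * (4 + cmod v)) @ \oo --> 0 * (4 + cmod v).
    by apply: cvgM; [exact: d0 | exact: cvg_cst].
  rewrite mul0r in cv.
  rewrite -(cvg_lim _ cv) //; apply: limr_ge.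
    by apply/cvg_ex; eexists; exact: cv.
  by exists j0 => // N /= jN; exact: xb.
apply/eqP; rewrite -subr_eq0 -/x -cmod_eq0 eq_le x0; exact: cmod_ge0.
Qed.

(** Square summability leaves room for dividing the coefficients of the [j]-th
    block by weights [d j] tending to zero; multiplying the blocks by these weights
    again turns the bounded partial sums of [polynomial_chain] into a uniformly
    convergent series. *)
Lemma sparse_blocks_function (lo rho : nat -> nat) (a : nat -> R) (T : R) :
  (forall x, 0 <= a x) -> (forall X, \sum_(x < X) a x ^+ 2 <= T) -> (0 < lo 0)%N ->
  (forall j, lo j + 2 * rho j < lo j.+1)%N ->
  (forall j, 4 * (lo j + 2 * rho j) <= rho j.+1)%N ->
  exists f : R -> R[i], [/\ ccontc f, f (- 2^-1) = f 2^-1,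
    forall n : int, (forall j x, n = Posz x -> ~~ (lo j <= x <= lo j + 2 * rho j)%N) ->
      fourier_coef f n = 0 &
    forall j x, (lo j <= x <= lo j + 2 * rho j)%N ->
      a x <= cmod (fourier_coef f x)].
Proof.
move=> a0 aT lo0 lo1 rho1; have [K K0 chain] := polynomial_chain R.
pose tb j := \sum_(i < (2 * rho j).+1) a (lo j + i)%N ^+ 2.
pose t j := tb j + 2^-1 ^+ j.
have tb0 j : 0 <= tb j by apply: sumr_ge0 => i _; exact: sqr_ge0.
have t0 j : 0 < t j by rewrite ltr_wpDl // exprn_gt0.
have tbT J : \sum_(j < J) tb j <= \sum_(x < lo J) a x ^+ 2.
  elim: J => [|J IH]; first by rewrite big_ord0; apply: sumr_ge0 => i _; exact: sqr_ge0.
  rewrite big_ord_recr /=.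
  rewrite -(big_mkord xpredT (fun x => a x ^+ 2)).
  have lJ : (lo J + (2 * rho J).+1 <= lo J.+1)%N by rewrite addnS.
  rewrite (big_cat_nat (n := lo J)) //=; last by apply: leq_trans lJ; exact: leq_addr.
  rewrite (big_cat_nat (n := (lo J + (2 * rho J).+1)%N) (m := lo J)) //=; last exact: leq_addr.
  rewrite addrA -[leLHS]addr0; apply: lerD; last first.
    by apply: sumr_ge0 => i _; exact: sqr_ge0.
  apply: lerD; first by rewrite big_mkord.
  rewrite -{1}(add0n (lo J)) big_addn addKn big_mkord /tb.
  by apply: ler_sum => i _; rewrite addnC.
have geo J : \sum_(j < J) 2^-1 ^+ j <= 2 :> R.
  suff -> : \sum_(j < J) 2^-1 ^+ j = 2 - 2 * 2^-1 ^+ J :> R.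
    by rewrite gerBl mulr_ge0 // exprn_ge0.
  elim: J => [|J IH]; first by rewrite big_ord0 expr0; lra.
  by rewrite big_ord_recr /= IH exprS; field.
have tT J : \sum_(j < J) t j <= T + 2.
  by rewrite big_split /=; apply: lerD; [exact: le_trans (tbT J) (aT _) | exact: geo].
have [d [B [d0 ddec dcv dB]]] := summable_weights t0 tT.
have B0 : 0 <= B by have := dB 0; rewrite big_ord0.
(* makes the squares of [beta] add up to at most [16^-1] *)
pose L := 4 * K * (B + 1).
have L0 : 0 < L by rewrite !mulr_gt0 //; lra.
pose beta j := K * Num.sqrt (t j) / (d j * L).
have dL j : 0 < d j * L by rewrite mulr_gt0.
have beta2 j : beta j ^+ 2 = K ^+ 2 / L ^+ 2 * (t j / d j ^+ 2).
  rewrite /beta expr_div_n exprMn sqr_sqrtr ?(ltW (t0 j)) //.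
  have dn0 : d j != 0 by rewrite gt_eqF.
  have Ln0 : L != 0 by rewrite gt_eqF.
  by move: Ln0; generalize L => l ln0; field; rewrite dn0 ln0.
have KL : K ^+ 2 / L ^+ 2 * B <= 16^-1.
  have -> : K ^+ 2 / L ^+ 2 * B = 16^-1 * (B / (B + 1) ^+ 2).
    rewrite /L; field; rewrite !gt_eqF //; lra.
  rewrite ger_pMr ?invr_gt0 // ler_pdivrMr ?exprn_gt0 //; last lra.
  by nra.
have [|||||||U [U0 U1 Uout Uin]] :=
  chain lo rho (fun j x => a x / (d j * L)) beta.
- by move=> j x; rewrite divr_ge0 // ltW.
- move=> j; apply: divr_ge0; last exact: ltW.
  by apply: mulr_ge0; [exact: ltW | exact: sqrtr_ge0].
- move=> j; under eq_bigr do rewrite beta2.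
  rewrite -mulr_sumr; apply: le_trans KL; rewrite ler_wpM2l //.
  by rewrite divr_ge0 ?sqr_ge0.
- by [].
- by [].
- by [].
- move=> j; under eq_bigr do rewrite expr_div_n.
  rewrite -mulr_suml -/(tb j) beta2.
  have gen (k l x y : R) : l != 0 -> x != 0 ->
      k ^+ 2 / l ^+ 2 * (y / x ^+ 2) = k ^+ 2 * (y / (x * l) ^+ 2).
    by move=> l0 x0; field; rewrite l0 x0.
  rewrite gen ?gt_eqF // ler_wpM2l ?sqr_ge0 // ler_wpM2r ?invr_ge0 ?sqr_ge0 //.
  by rewrite /t lerDl exprn_ge0.
have [f [cf f12 fU]] := @weighted_trig_series (fun j => U j.+1) d
   (fun j => U1 j.+1) ddec dcv.
have lo_lt i j : (i < j)%N -> (lo i + 2 * rho i < lo j)%N.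
  elim: j => // j IH; rewrite ltnS leq_eqVlt => /orP[/eqP <-//|/IH h].
  by apply: leq_trans h _; apply: leq_trans (ltnW (lo1 j)); exact: leq_addr.
have disj i j x : (lo i <= x <= lo i + 2 * rho i)%N ->
    (lo j <= x <= lo j + 2 * rho j)%N -> i = j.
  move=> /andP[ix xi] /andP[jx xj].
  case: (ltngtP i j) => // /lo_lt h.
    by have := leq_ltn_trans xi (leq_trans h jx); rewrite ltnn.
  by have := leq_ltn_trans xj (leq_trans h ix); rewrite ltnn.
have cLf : ccontc (fun t => L%:C%C * f t).
  by apply: ccontcM => //; exact: ccontc_cst.
exists (fun t => L%:C%C * f t); split=> //; first by rewrite f12.
- move=> n nout; rewrite fourier_coefZ //.
  rewrite (fU n 0 0) ?mulr0 // => j _; rewrite fourier_coef_trig_poly.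
  case: n nout => // x nout.
  elim: j.+1 => [|i IH]; first by rewrite U0 coef0.
  by rewrite Uout // nout.
- move=> j x xj; have Ulow i : (i <= j)%N -> (U i)`_x = 0.
    elim: i => [|i IH] ij; first by rewrite U0 coef0.
    rewrite Uout; first exact: IH (ltnW ij).
    apply/negP => xi.
    by move: ij; rewrite (disj _ _ _ xi xj) ltnn.
  have Uhigh k : (U (j.+1 + k)%N)`_x = (U j.+1)`_x.
    elim: k => [|k IH]; first by rewrite addn0.
    rewrite addnS Uout; first exact: IH.
    apply/negP => xi.
    by have := disj _ _ _ xi xj; lia.
  have [_ ax] := Uin j x xj.
  rewrite fourier_coefZ // (fU x j ((U j.+1)`_x)) => [|i ij|i ji]; last first.
  + by rewrite fourier_coef_trig_poly /= -(subnKC ji) -addSn Uhigh.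
  + by rewrite fourier_coef_trig_poly /= Ulow.
  rewrite mulrA -rmorphM cmodM cmod_real ger0_norm; last first.
    by rewrite mulr_ge0 // ltW.
  by move: ax; rewrite ler_pdivrMr // mulrC [d j * L]mulrC.
Qed.

End Series.

(** * Long dyadic intervals are massive *)

Section Dyadic.
Variables (R : realType) (r : nat -> R).
Hypothesis r_bound : forall n, 0 < r n < 2 ^ (n%:Z - 10).

Definition half_length k := Num.truncn (r k).

Lemma half_length_le k n : (n <= half_length k)%N = (n%:R <= r k).
Proof. by rewrite truncn_ge_nat // ltW //; case/andP: (r_bound k). Qed.

Lemma radius_lt k : r k < 2 ^+ k / 1024.
Proof.
have /andP[_] := r_bound k; rewrite expfzDr //.
have -> : (2 : R) ^ (- 10) = (2 ^+ 10)^-1 by [].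
by have -> : 2 ^+ 10 = 1024 :> R by rewrite !exprS expr0; ring.
Qed.

Lemma half_length_small k : (1024 * half_length k <= 2 ^ k)%N.
Proof.
have h : (half_length k)%:R <= r k by rewrite -half_length_le.
by rewrite -(ler_nat R) natrM natrX; have := radius_lt k; lra.
Qed.

Lemma dyadicP (n : int) : dyadic_intervals r n <->
  exists k x, n = Posz x /\ (2 ^ k - half_length k <= x <= 2 ^ k + half_length k)%N.
Proof.
have key k : (2 ^+ k - r k <= n%:~R <= 2 ^+ k + r k) = (`|n - (2 ^ k)%N|%N <= half_length k)%N.
  rewrite half_length_le natr_absz -[r k in RHS]addr0 intr_norm rmorphB /= -pmulrn natrX.
  by rewrite addr0 ler_distl.
have sm k := half_length_small k.
rewrite /dyadic_intervals /=; split.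
  move=> [k _ /=]; rewrite in_itv /= key => h; exists k.
  have := sm k; move: h; set p := (2 ^ k)%N; set q := half_length k => h1 h2.
  case: n h1 {key} => x h1; last by lia.
  by exists x; split=> //; lia.
move=> [k [x [nx h]]]; exists k => //=; rewrite in_itv /= key nx.
by have := sm k; move: h; set p := (2 ^ k)%N; set q := half_length k; lia.
Qed.

Lemma dyadic_block_unique k l x : (2 ^ k - half_length k <= x <= 2 ^ k + half_length k)%N ->
  (2 ^ l - half_length l <= x <= 2 ^ l + half_length l)%N -> k = l.
Proof.
wlog kl : k l / (k <= l)%N.
  by move=> H h1 h2; case: (leqP k l) => [|/ltnW] kl; [|symmetry]; apply: H.
move: kl; rewrite leq_eqVlt => /orP[/eqP //|kl].
have h : (2 * 2 ^ k <= 2 ^ l)%N by rewrite -expnS leq_exp2l.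
have := half_length_small k; have := half_length_small l; move: h.
by set p := (2 ^ k)%N; set q := (2 ^ l)%N; lia.
Qed.

Lemma ell2_partial_sums (a : int -> R[i]) : ell2 (dyadic_intervals r) a ->
  exists T : R, forall X, \sum_(x < X)
    (if `[< dyadic_intervals r (Posz x) >] then cmod (a x) else 0) ^+ 2 <= T.
Proof.
rewrite /ell2 /summable; set A := dyadic_intervals r.
set g := (fun n => `|(_ %:E)|%E); set E := esum A g => Efin.
have E0 : (0 <= E)%E by apply: esum_ge0 => n _; exact: abse_ge0.
have Ef : E \is a fin_num by rewrite ge0_fin_numE.
exists (fine E) => X; rewrite -lee_fin fineK //.
pose s := [seq Posz x | x <- iota 0 X & `[< A (Posz x) >]].
apply: esum_ge; exists [set` s].
  split; first exact: finite_seq.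
  by move=> n /= /mapP[x]; rewrite mem_filter => /andP[/asboolP Ax _] ->.
have us : uniq s.
  by rewrite map_inj_uniq ?filter_uniq ?iota_uniq // => x y [].
rewrite -fsbig_seq // big_map big_filter -(big_mkord xpredT (fun x =>
  (if `[< A (Posz x) >] then cmod (a x) else 0) ^+ 2)) /index_iota subn0.
rewrite [leRHS]big_mkcond -sumEFin; apply: lee_sum => x _.
case: ifP => _; last by rewrite expr0n.
by rewrite /g /= lee_fin ler_norm.
Qed.

(** Along each residue class of exponents modulo [C] the blocks are as sparse
    as [sparse_blocks_function] requires, since their lengths are comparable to
    [2 ^ k]. *)
Lemma massive_dyadic (eps : R) : 0 < eps -> (forall n, eps * 2 ^+ n < r n) ->
  massive R (dyadic_intervals r).
Proof.
move=> e0 er a /ell2_partial_sums[T aT].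
set b := (fun x : nat => if `[< dyadic_intervals r (Posz x) >] then cmod (a x) else 0).
have b0 x : 0 <= b x by rewrite /b; case: ifP => // _; exact: cmod_ge0.
pose C := (Num.truncn (8 / eps)).+3.
have C0 : (0 < C)%N by [].
have eC : 8 <= eps * 2 ^+ C.
  have h : 8 / eps < (Num.truncn (8 / eps)).+1%:R.
    by have /andP[] := truncn_itv (ltW (divr_gt0 (ltr0Sn R 7) e0)).
  rewrite mulrC -ler_pdivrMr // ltW // (lt_le_trans h) //.
  rewrite -natrX ler_nat; apply: (@leq_trans C); first by rewrite /C ltnS (leqW (leqnSn _)).
  by apply/ltnW/ltn_expl.
have sm := half_length_small.
have big k : (8 * 2 ^ k <= half_length (k + C))%N.
  rewrite half_length_le natrM natrX; apply: ltW; apply: le_lt_trans (er _).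
  by rewrite exprD mulrCA [leLHS]mulrC; apply: ler_wpM2l => //; exact: exprn_ge0.
pose ex c j := (c + j * C)%N.
have exS c j : ex c j.+1 = (ex c j + C)%N by rewrite /ex mulSnr addnA.
pose lo c j := (2 ^ ex c j - half_length (ex c j))%N.
have top c j : (lo c j + 2 * half_length (ex c j) = 2 ^ ex c j + half_length (ex c j))%N.
  by have := sm (ex c j); rewrite /lo; set p := (2 ^ _)%N; set q := half_length _; lia.
have blockA c j x : (lo c j <= x <= lo c j + 2 * half_length (ex c j))%N ->
    dyadic_intervals r (Posz x).
  by rewrite top => h; apply/dyadicP; exists (ex c j), x.
have /choice[F FP] : forall c : nat, exists f : R -> R[i], [/\ ccontc f,
    f (- 2^-1) = f 2^-1,
    forall n : int, (forall j x, n = Posz x ->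
        ~~ (lo c j <= x <= lo c j + 2 * half_length (ex c j))%N) ->
      fourier_coef f n = 0 &
    forall j x, (lo c j <= x <= lo c j + 2 * half_length (ex c j))%N ->
      b x <= cmod (fourier_coef f x)].
  move=> c; apply: (@sparse_blocks_function R (lo c) (fun j => half_length (ex c j)) b T) => //.
  - have := sm (ex c 0); have : (0 < 2 ^ ex c 0)%N by rewrite expn_gt0.
    by rewrite /lo; set p := (2 ^ _)%N; set q := half_length _; lia.
  - move=> j; rewrite top /lo exS.
    have := sm (ex c j); have := sm (ex c j + C)%N.
    have := big (ex c j); have : (0 < 2 ^ ex c j)%N by rewrite expn_gt0.
    set p := (2 ^ _)%N; set p' := (2 ^ _)%N; set q := half_length _; set q' := half_length _; lia.
  - move=> j; rewrite top exS; have := sm (ex c j); have := big (ex c j).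
    by set p := (2 ^ _)%N; set q := half_length _; set q' := half_length _; lia.
exists (fun t => \sum_(c < C) F c t).
have cF : ccontc (fun t => \sum_(c < C) F c t).
  by apply: ccontc_sum => c; have [] := FP c.
have coefF n : fourier_coef (fun t => \sum_(c < C) F c t) n
    = \sum_(c < C) fourier_coef (F c) n.
  by rewrite fourier_coef_sum // => c; have [] := FP c.
split.
- split; first by apply/within_continuous_Re_Im.
  by apply: eq_bigr => c _; have [] := FP c.
- move=> n nA; rewrite coefF big1 // => c _.
  have [_ _ h _] := FP c; apply: h => j x nx; apply/negP => /blockA.
  by rewrite -nx.
- move=> n nA; have /dyadicP[k [x [nx xk]]] := nA.
  have kC : (k %% C < C)%N by rewrite ltn_mod.
  rewrite coefF (bigD1 (Ordinal kC)) //= big1 ?addr0; last first.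
    move=> c; rewrite -val_eqE /= => ck.
    have [_ _ h _] := FP c; apply: h => j y; rewrite nx => -[<-].
    rewrite top; apply/negP => /(dyadic_block_unique xk) E.
    by move: ck; rewrite E /ex addnC modnMDl modn_small ?ltn_ord ?eqxx.
  have [_ _ _ h] := FP (k %% C)%N.
  rewrite !normc_cmod lecR nx.
  have -> : cmod (a x) = b x by rewrite /b -nx; case: asboolP.
  apply: (h (k %/ C)%N); rewrite top /lo /ex addnC -divn_eq.
  exact: xk.
Qed.

End Dyadic.

(** * Riesz products *)

Lemma signed_digits_bound L (e : nat -> int) : (forall j, -1 <= e j <= 1) ->
  3 * `|\sum_(j < L) e j * 4 ^+ j| < 4 ^+ L.
Proof.
elim: L e => [|L IH] e e1; first by rewrite big_ord0 normr0 mulr0 expr0.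
rewrite big_ord_recr /= exprS.
have h := IH e e1; set x := \sum_(j < L) _ in h *; set p := 4 ^+ L in h *.
have p0 : 0 < p by rewrite exprn_gt0.
have [e'|[e'|e']] : e L = -1 \/ e L = 0 \/ e L = 1 by have := e1 L; clear; lia.
all: by rewrite e'; clear -p0 h; lia.
Qed.

Lemma signed_digits_zero L (e : nat -> int) : (forall j, -1 <= e j <= 1) ->
  \sum_(j < L) e j * 4 ^+ j = 0 -> forall j, (j < L)%N -> e j = 0.
Proof.
elim: L e => [//|L IH] e e1; rewrite big_ord_recl expr0 mulr1 /=.
have -> : \sum_(i < L) e (bump 0 i) * 4 ^+ bump 0 i
    = 4 * \sum_(i < L) e i.+1 * 4 ^+ i.
  by rewrite mulr_sumr; apply: eq_bigr => i _; rewrite /bump /= exprS mulrCA.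
move=> E; have e0 : e 0 = 0 by have := e1 0; move: E; move: (e 0) (\sum_(i < L) _); clear; lia.
have /(IH (fun j => e j.+1)) h : \sum_(i < L) e i.+1 * 4 ^+ i = 0.
  by move: E; rewrite e0; move: (\sum_(i < L) _); clear; lia.
by case=> [//|j]; rewrite ltnS => jL; apply: h => // i; exact: e1.
Qed.

(** The residue modulo 4 determines the lowest digit among -1, 0, 1, and no digit
    has residue 2: so a power of two with such an expansion is a power of four,
    whose expansion is the obvious one. *)
Lemma signed_digits_power L q (e : nat -> int) : (forall j, -1 <= e j <= 1) ->
  \sum_(j < L) e j * 4 ^+ j = 2 ^+ q ->
  exists j, [/\ (j < L)%N, e j = 1 & forall i, (i < L)%N -> i != j -> e i = 0].
Proof.
elim: L q e => [|L IH] q e e1.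
  by rewrite big_ord0 => /esym/eqP; rewrite expf_eq0 andbF.
rewrite big_ord_recl expr0 mulr1 /=.
have -> : \sum_(i < L) e (bump 0 i) * 4 ^+ bump 0 i
    = 4 * \sum_(i < L) e i.+1 * 4 ^+ i.
  by rewrite mulr_sumr; apply: eq_bigr => i _; rewrite /bump /= exprS mulrCA.
case: q => [|[|q]].
- rewrite expr0 => E; have e0 : e 0 = 1 by have := e1 0; move: E; move: (e 0) (\sum_(i < L) _); clear; lia.
  have /(@signed_digits_zero L (fun j => e j.+1)) h : \sum_(i < L) e i.+1 * 4 ^+ i = 0.
    by move: E; rewrite e0; move: (\sum_(i < L) _); clear; lia.
  exists 0; split=> // -[//|i] iL _; apply: h => // j; exact: e1.
- rewrite expr1 => E; exfalso; have := e1 0; move: E; move: (e 0) (\sum_(i < L) _); clear; lia.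
- rewrite !exprS mulrA => E.
  have e0 : e 0 = 0 by have := e1 0; move: E; move: (e 0) (\sum_(i < L) _); clear; lia.
  have /(IH q (fun j => e j.+1)) : \sum_(i < L) e i.+1 * 4 ^+ i = 2 ^+ q.
    by move: E; rewrite e0; move: (\sum_(i < L) _); clear; lia.
  case=> [j|j [jL ej h]]; first exact: e1.
  by exists j.+1; split=> // -[//|i]; rewrite ltnS => iL; rewrite eqSS; exact: h.
Qed.

Section RieszProduct.
Variable R : realType.

Definition digit (i : 'I_3) : int := i%:Z - 1.

(** The frequency of the term of the expanded Riesz product that is selected by the
    digits [e]. *)
Definition riesz_freq L m (e : {ffun 'I_L -> 'I_3}) : int :=
  \sum_(j < L) digit (e j) * (2 ^ (m + 2 * j))%N.

Definition nat_digit L (e : {ffun 'I_L -> 'I_3}) (i : nat) : int :=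
  if insub i is Some k then digit (e k) else 0.

Lemma nat_digitE L (e : {ffun 'I_L -> 'I_3}) (k : 'I_L) :
  nat_digit e k = digit (e k).
Proof. by rewrite /nat_digit valK. Qed.

Lemma nat_digit_bound L (e : {ffun 'I_L -> 'I_3}) i : -1 <= nat_digit e i <= 1.
Proof.
rewrite /nat_digit; case: insubP => // k _ _.
by rewrite /digit; have := ltn_ord (e k); lia.
Qed.

Lemma riesz_freqE L m (e : {ffun 'I_L -> 'I_3}) : riesz_freq m e =
  (2 ^ m)%N%:Z * \sum_(j < L) nat_digit e j * 4 ^+ j.
Proof.
rewrite /riesz_freq mulr_sumr; apply: eq_bigr => j _.
rewrite nat_digitE mulrCA; congr (_ * _).
by rewrite expnD PoszM; congr (_ * _); rewrite expnM -!natz natrX.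
Qed.

Definition unit_digits L (j : 'I_L) : {ffun 'I_L -> 'I_3} :=
  [ffun i => if i == j then ord0 else inord 1].

(** Riesz products: they are nonnegative with mean one, and their coefficients
    at the frequencies [2 ^ (m + 2 * j)] can be given any phase. *)
Lemma riesz_product L m (f : R -> R[i]) (S : R) : ccontc f ->
  (forall t, circle R t -> complex.Re (f t) <= S) ->
  (forall e : {ffun 'I_L -> 'I_3}, (forall j, e != unit_digits j) ->
     fourier_coef f (- riesz_freq m e) = 0) ->
  \sum_(j < L) cmod (fourier_coef f (2 ^ (m + 2 * j))%N) <= 2 * S.
Proof.
move=> cf fS f0.
pose c (j : 'I_L) : R[i] := let v := fourier_coef f (2 ^ (m + 2 * j))%N in
  if v == 0 then 1 else v / (cmod v)%:C%C.
have c1 j : cmod (c j) = 1.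
  rewrite /c; case: eqVneq => [_|v0]; first exact: cmod1.
  by rewrite cmodM cmodV cmod_real ger0_norm ?cmod_ge0 // divff // cmod_eq0.
have cv j : (c j)^*%C * fourier_coef f (2 ^ (m + 2 * j))%N
    = (cmod (fourier_coef f (2 ^ (m + 2 * j))%N))%:C%C.
  rewrite /c; case: eqVneq => [->|v0]; first by rewrite mulr0 cmod0.
  set v := fourier_coef _ _ in v0 *.
  rewrite rmorphM [X in _ * X * _]conjc_inv conjc_real mulrAC [_^*%C * _]mulrC mulcJ.
  have : (cmod v)%:C%C != 0 by rewrite (inj_eq (@complexI R) _ 0) cmod_eq0.
  by rewrite rmorphXn /= => h; rewrite expr2 mulfK.
pose kap j (i : 'I_3) : R[i] :=
  if i == 0%N :> nat then (c j)^*%C / 2 else if i == 1%N :> nat then 1 else c j / 2.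
pose N (j : 'I_L) : int := (2 ^ (m + 2 * j))%N.
pose P t : R := \prod_(j < L) (1 + complex.Re (c j * wave (N j) t)).
have factE j t : (1 + complex.Re (c j * wave (N j) t))%:C%C
    = \sum_(i < 3) kap j i * wave (digit i * N j) t.
  have -> z : (1 + complex.Re z)%:C%C = 1 + (z + z^*%C) / 2 :> R[i].
    by rewrite -ReJ_add; apply: complex_eqP => /=; rewrite ?addr0.
  rewrite rmorphM.
  rewrite !big_ord_recl big_ord0 /kap /digit addr0.
  have -> : (0%:Z - 1) * N j = - N j by rewrite sub0r mulN1r.
  have -> : (bump 0 0)%:Z - 1 = 0 by [].
  have -> : (bump 0 (bump 0 0))%:Z - 1 = 1 by [].
  rewrite mul0r mul1r eqxx.
  have -> : wave 0 t = 1 by rewrite /wave mulr0z mulr0 mul0r expi0.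
  have -> : wave (- N j) t = (wave (N j) t)^*%C.
    by rewrite /wave mulrNz mulrN mulNr expiN.
  by move: (wave (N j) t) => w /=; field.
have PE t : (P t)%:C%C = \sum_(e : {ffun 'I_L -> 'I_3})
    (\prod_j kap j (e j)) * wave (riesz_freq m e) t.
  rewrite /P rmorph_prod /=; under eq_bigr do rewrite factE.
  rewrite bigA_distr_bigA /=; apply: eq_bigr => e _; rewrite big_split /=.
  congr (_ * _); rewrite /riesz_freq.
  rewrite (big_morph (fun n => wave n t) (fun x y => waveD x y t) (id1 := 1)) //.
  by rewrite /wave mulr0z mulr0 mul0r expi0.
have P0 t : 0 <= P t.
  apply: prodr_ge0 => j _; have := Re_le_cmod (c j * wave (N j) t).
  by rewrite cmodM c1 cmod_expi mulr1 ler_norml => /andP[]; lra.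
have pair g : ccontc g -> circle_integral (fun t => (P t)%:C%C * g t)
    = \sum_(e : {ffun 'I_L -> 'I_3}) (\prod_j kap j (e j)) * fourier_coef g (- riesz_freq m e).
  move=> cg; have -> : (fun t => (P t)%:C%C * g t) = (fun t => \sum_(e : {ffun 'I_L -> 'I_3})
      (\prod_j kap j (e j)) * (g t * wave (- - riesz_freq m e) t)).
    apply/funext => t; rewrite PE mulr_suml; apply: eq_bigr => e _.
    by rewrite opprK -mulrA [g t * _]mulrC.
  rewrite circle_integral_sum; last first.
    move=> e; apply: ccontcM; first exact: ccontc_cst.
    by apply: ccontcM => //; exact: ccontc_wave.
  apply: eq_bigr => e _; rewrite circle_integralZ ?fourier_coefE //.
  by apply: ccontcM => //; exact: ccontc_wave.
have cP : ccontc (fun t => (P t)%:C%C).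
  under [X in ccontc X]funext do rewrite PE.
  apply: ccontc_sum => e.
  by apply: ccontcM; [exact: ccontc_cst | exact: ccontc_wave].
(* the mean of the product is its constant coefficient *)
have meanP : circle_integral (fun t => (P t)%:C%C) = 1.
  have := pair (fun=> 1) (ccontc_cst _).
  under [X in circle_integral X = _]funext do rewrite mulr1.
  move=> ->; pose z : {ffun 'I_L -> 'I_3} := [ffun => inord 1].
  have wE : (fun=> 1) = wave 0 :> (R -> R[i]).
    by apply/funext => t; rewrite /wave mulr0z mulr0 mul0r expi0.
  rewrite (bigD1 z) //= [X in _ + X]big1 ?addr0 => [|e ez].
    have zz : riesz_freq m z = 0.
      by rewrite /riesz_freq big1 // => j _; rewrite ffunE /digit inordK // subrr mul0r.
    rewrite zz wE fourier_coef_wave oppr0 eqxx mulr1 big1 // => j _.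
    by rewrite /z ffunE /kap inordK.
  rewrite wE fourier_coef_wave eq_sym oppr_eq0.
  case: eqP => [|_]; last by rewrite mulr0.
  rewrite riesz_freqE => /eqP; rewrite mulf_eq0 => /orP[|/eqP h].
    by rewrite eqz_nat expn_eq0.
  case/eqP: ez; apply/ffunP => j; rewrite ffunE; apply/val_inj; rewrite /= inordK //.
  have := signed_digits_zero (nat_digit_bound e) h (ltn_ord j).
  by rewrite nat_digitE /digit; lia.
have uinj : injective (@unit_digits L).
  move=> i j /ffunP/(_ i); rewrite !ffunE eqxx; case: eqP => // _ /(congr1 val) /=.
  by rewrite inordK.
have E : circle_integral (fun t => (P t)%:C%C * f t)
    = (2^-1 * \sum_(j < L) cmod (fourier_coef f (2 ^ (m + 2 * j))%N))%:C%C.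
  rewrite pair // (bigID (mem [set unit_digits j | j in 'I_L]%SET)) /=.
  rewrite [X in _ + X]big1 ?addr0 => [|e eu]; last first.
    rewrite f0 ?mulr0 // => j; apply: contraNneq eu => ->; exact: imset_f.
  rewrite big_imset /=; last by move=> i j _ _; exact: uinj.
  rewrite rmorphM rmorph_sum mulr_sumr; apply: eq_bigr => j _.
  have kE : \prod_i kap i (unit_digits j i) = (c j)^*%C / 2.
    rewrite (bigD1 j) //= big1 ?mulr1 => [|i ij]; first by rewrite ffunE eqxx.
    by rewrite ffunE (negPf ij) /kap inordK.
  have fE : riesz_freq m (unit_digits j) = - (2 ^ (m + 2 * j))%N%:Z.
    rewrite /riesz_freq (bigD1 j) //= big1 ?addr0 => [|i ij].
      by rewrite ffunE eqxx /digit /= sub0r mulN1r.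
    by rewrite ffunE (negPf ij) /digit inordK // subrr mul0r.
  rewrite kE fE opprK mulrAC cv mulrC; congr (_ * _).
  by rewrite fmorphV rmorph_nat.
have Re_E := congr1 (@complex.Re R) E; rewrite /= in Re_E.
set X := \sum_(j < L) _ in Re_E *.
suff : 2^-1 * X <= S by lra.
rewrite -Re_E.
have Re_P := congr1 (@complex.Re R) meanP; rewrite /= in Re_P.
rewrite -[S]mulr1 -Re_P -meanZ; last by have [] := cP.
apply: ler_mean; first by have [] := ccontcM cP cf.
  by apply: ccontM; [exact: ccont_cst | have [] := cP].
by move=> t /fS ft; rewrite ReZ /= mulrC ler_wpM2r.
Qed.

End RieszProduct.

(** * Short dyadic intervals are not massive *)

Section NotMassive.
Variables (R : realType) (r : nat -> R).
Hypothesis r_incr : {homo r : m n / (m <= n)%N >-> m <= n}.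
Hypothesis r_bound : forall n, 0 < r n < 2 ^ (n%:Z - 10).

(** As [r] is nondecreasing, one short interval forces the preceding ones to be
    short as well: this gives long windows of exponents in which the
    intervals are negligible compared with every [2 ^ k] of the window. *)
Lemma short_window : ~ (exists2 eps : R, 0 < eps & forall n, eps * 2 ^+ n < r n) ->
  forall L N0, exists2 m, (N0 <= m)%N &
    forall k, (k.+1 < m + 2 * L)%N -> (half_length r k < 2 ^ m)%N.
Proof.
move=> noeps L N0; have /andP[r0 r1] := r_bound 0.
pose q := (2 * L + N0).+1; pose eps := r 0 / 2 ^+ q.
have q0 : 0 < 2 ^+ q :> R by rewrite exprn_gt0.
have r01 : r 0 < 1.
  apply: lt_le_trans (radius_lt r_bound 0) _.
  by rewrite expr0 mul1r invf_le1 ?ler1n ?ltr0n.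
have [n rn] : exists n, r n <= eps * 2 ^+ n.
  apply: contrapT => /forallNP h; apply: noeps; exists eps; first exact: divr_gt0.
  by move=> n; rewrite ltNge; apply/negP/h.
have qn : (q <= n)%N.
  have := le_trans (r_incr (leq0n n)) rn; rewrite /eps mulrAC ler_pdivlMr //.
  by rewrite ler_pM2l // ler_eXn2l // ltr1n.
exists (n - 2 * L)%N; first by move: qn; rewrite /q; lia.
move=> k kn; have kn' : (k <= n)%N by move: kn qn; rewrite /q; lia.
rewrite -(ltr_nat R) natrX.
have h : (half_length r k)%:R <= r k by rewrite -(half_length_le r_bound).
apply: le_lt_trans h _; apply: le_lt_trans (r_incr kn') _; apply: le_lt_trans rn _.
have En : 2 ^+ n = 2 ^+ (n - 2 * L) * 2 ^+ (2 * L) :> R.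
  by rewrite -exprD subnK //; move: qn; rewrite /q; lia.
rewrite /eps En mulrCA gtr_pMr ?exprn_gt0 // mulrAC ltr_pdivrMr // mul1r.
apply: (@lt_le_trans _ _ (2 ^+ (2 * L))).
  by rewrite gtr_pMl ?exprn_gt0.
by rewrite ler_weXn2l ?ler1n // /q; lia.
Qed.

(** The frequencies of the Riesz product are multiples of [2 ^ m], so those that lie
    in an interval of the window are equal to its center; the intervals before and
    after the window are out of reach by size. *)
Lemma riesz_freq_notin L m (e : {ffun 'I_L -> 'I_3}) :
  (forall k, (k.+1 < m + 2 * L)%N -> (half_length r k < 2 ^ m)%N) ->
  (forall j, e != unit_digits j) -> ~ dyadic_intervals r (- riesz_freq m e).
Proof.
move=> win eu /(dyadicP r_bound)[k [y [Ey yk]]].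
pose d i := - nat_digit e i.
have d1 i : -1 <= d i <= 1 by rewrite /d; have := nat_digit_bound e i; lia.
have bound := signed_digits_bound L d1.
have yE : y%:Z = (2 ^ m)%N%:Z * \sum_(j < L) d j * 4 ^+ j.
  rewrite -Ey riesz_freqE -mulrN -sumrN; congr (_ * _).
  by apply: eq_bigr => j _; rewrite mulNr.
set x := \sum_(j < L) _ in bound yE.
have sm := half_length_small r_bound k.
have p0 : (0 < 2 ^ m)%N by rewrite expn_gt0.
have k0 : (0 < 2 ^ k)%N by rewrite expn_gt0.
have [km|mk] := ltnP k m.
  have h : (2 * 2 ^ k <= 2 ^ m)%N by rewrite -expnS leq_exp2l.
  have x1 : 0 < x.
    move: yE yk sm k0 p0; clear; move: x (2 ^ m)%N (2 ^ k)%N (half_length r k); nia.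
  have : (2 ^ m)%N%:Z <= y by rewrite yE ler_pMr // -gtz0_ge1.
  move: yk sm h k0; move: (2 ^ m)%N (2 ^ k)%N (half_length r k); clear; lia.
have [kw|wk] := ltnP k.+1 (m + 2 * L).
  have rk := win k kw.
  have Ek : (2 ^ k = 2 ^ m * 2 ^ (k - m))%N by rewrite -expnD subnKC.
  have Ex : x = (2 ^ (k - m))%N.
    move: yE yk sm rk; rewrite Ek; move: (2 ^ m)%N (2 ^ (k - m))%N (half_length r k) => p s q.
    move=> yE /andP[h1 h2] h3 h4.
    have a1 : p%:Z * (s%:Z - x) < p%:Z by rewrite mulrBr -yE -PoszM; lia.
    have a2 : p%:Z * (x - s%:Z) < p%:Z by rewrite mulrBr -yE -PoszM; lia.
    by move: a1 a2; nia.
  have Ex' : \sum_(j < L) d j * 4 ^+ j = 2 ^+ (k - m).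
    by rewrite -/x Ex -!natz natrX.
  have [j [jL dj dz]] := signed_digits_power d1 Ex'.
  have /negP := eu (Ordinal jL); apply; apply/eqP/ffunP => i.
  rewrite ffunE; apply/val_inj => /=.
  have := nat_digitE e i; case: eqP => [->|/eqP ij] /=.
    by move: dj; rewrite /d /digit /=; lia.
  have := dz i (ltn_ord i); rewrite -val_eqE /= in ij; move=> /(_ ij).
  by rewrite /d inordK // /digit; lia.
have hL : (2 ^ m * 4 ^ L <= 2 * 2 ^ k)%N.
  by rewrite -(expnM 2 2) -expnD -expnS leq_exp2l.
have E4 : (4 ^+ L : int) = (4 ^ L)%N by rewrite -!natz natrX.
rewrite E4 in bound.
have : 3 * y%:Z < (2 * 2 ^ k)%N.
  apply: (@lt_le_trans _ _ (2 ^ m * 4 ^ L)%N%:Z); last by rewrite lez_nat.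
  rewrite yE mulrCA PoszM ltr_pM2l ?ltz_nat //.
  by move: bound; move: (4 ^ L)%N; clear; lia.
move: yk sm k0; move: (2 ^ k)%N (half_length r k); clear; lia.
Qed.

(** A function with the coefficients [a] would have, for each [k], coefficients
    at least [8^-k] at the [16^k] powers of two of a window; their sum [2^k] is
    bounded by the Riesz product of this window, for all [k] at once. *)
Lemma not_massive : ~ (exists2 eps : R, 0 < eps & forall n, eps * 2 ^+ n < r n) ->
  ~ massive R (dyadic_intervals r).
Proof.
move=> /short_window win mass.
have /choice[M MP] : forall k, exists m, (k <= m)%N /\
    forall l, (l.+1 < m + 2 * 16 ^ k)%N -> (half_length r l < 2 ^ m)%N.
  by move=> k; have [m km h] := win (16 ^ k)%N k; exists m.
pose N k j : int := (2 ^ (M k + 2 * j))%N.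
pose g k n : R := 64^-1 ^+ k * \sum_(j < 16 ^ k) (n == N k j)%:R.
have g0 k n : 0 <= g k n.
  by rewrite mulr_ge0 ?exprn_ge0 ?invr_ge0 // sumr_ge0.
(* windows of different [k] may overlap; the cutoff [k < |n|] keeps the sum finite *)
pose w (n : int) : R := \sum_(k < `|n|) g k n.
have w0 n : 0 <= w n by apply: sumr_ge0.
pose a n : R[i] := (Num.sqrt (w n))%:C%C.
have a2 n : cmod (a n) ^+ 2 = w n.
  by rewrite cmod_real ger0_norm ?sqrtr_ge0 // sqr_sqrtr.
have count1 (c : int) (s : seq int) : uniq s -> \sum_(x <- s) (x == c)%:R <= 1 :> R.
  elim: s => [|x s IH] /=; first by rewrite big_nil.
  move=> /andP[xs us]; rewrite big_cons; case: eqP => [xc|_]; last by rewrite add0r IH.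
  rewrite big_seq big1 ?addr0 // => y ys; case: eqP => // yc.
  by move: xs; rewrite xc -yc ys.
have wsum (s : seq int) : uniq s -> \sum_(x <- s) w x <= 2.
  move=> us; pose K := (\sum_(x <- s) `|x|)%N.
  apply: (@le_trans _ _ (\sum_(x <- s) \sum_(k < K) g k x)).
    rewrite big_seq [leRHS]big_seq; apply: ler_sum => x xs.
    rewrite /w -(big_mkord xpredT (g ^~ x)) -(big_mkord xpredT (g ^~ x)).
    have xK : (`|x| <= K)%N by rewrite /K (big_rem x) //= leq_addr.
    by rewrite [leRHS](big_cat_nat (n := `|x|%N)) //= lerDl sumr_ge0.
  rewrite exchange_big /=; apply: (@le_trans _ _ (\sum_(k < K) 4^-1 ^+ k)).
    apply: ler_sum => k _; rewrite -mulr_sumr exchange_big /=.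
    apply: (@le_trans _ _ (64^-1 ^+ k * \sum_(j < 16 ^ k) 1)).
      rewrite ler_wpM2l ?exprn_ge0 ?invr_ge0 //; apply: ler_sum => j _.
      exact: count1.
    rewrite sumr_const card_ord natrX -exprMn.
    by have -> : 64^-1 * 16 = 4^-1 :> R by field.
  suff -> : \sum_(k < K) 4^-1 ^+ k = 4 / 3 - 4 / 3 * 4^-1 ^+ K :> R.
    have : 0 <= 4^-1 ^+ K :> R by rewrite exprn_ge0.
    lra.
  elim: (K) => [|k IH]; first by rewrite big_ord0 expr0; lra.
  by rewrite big_ord_recr /= IH exprS; field.
have ell2a : ell2 (dyadic_intervals r) a.
  rewrite /ell2 /summable; apply: (@le_lt_trans _ _ 2%:E); last exact: ltry.
  apply: ub_ereal_sup => _ [A [finA _] <-]; rewrite fsbig_finite //=.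
  have -> : (\sum_(x <- finmap.enum_fset (fset_set A)) `|(complex.Re `|a x| ^+ 2)%:E|)%E
      = (\sum_(x <- finmap.enum_fset (fset_set A)) w x)%:E.
    rewrite -sumEFin; apply: eq_bigr => x _.
    by rewrite /= ger0_norm ?sqr_ge0 // -/(cmod _) a2.
  by rewrite lee_fin wsum // finmap.fset_uniq.
have [f [cf fout fin]] := mass a ell2a.
have [cR cI] : ccontc f by case: cf => /within_continuous_Re_Im.
have [|t0 _ fS] := @EVT_max R (fun t => complex.Re (f t)) (- 2^-1) 2^-1 _ cR.
  by lra.
set S := complex.Re (f t0) in fS.
have NA k j : dyadic_intervals r (N k j).
  apply/(dyadicP r_bound); exists (M k + 2 * j)%N, (2 ^ (M k + 2 * j))%N.
  by rewrite leq_subr leq_addr.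
have low k (j : 'I_(16 ^ k)) : 8^-1 ^+ k <= cmod (a (N k j)).
  rewrite -(@ler_pXn2r _ 2) ?nnegrE ?exprn_ge0 ?cmod_ge0 ?invr_ge0 // a2.
  have kN : (k < `|N k j|)%N.
    rewrite /N absz_nat; have [kM _] := MP k.
    by apply: leq_ltn_trans kM _; apply: leq_ltn_trans (leq_addr (2 * j) _) _; exact: ltn_expl.
  rewrite /w (bigD1 (Ordinal kN)) //= -[leLHS]addr0 lerD ?sumr_ge0 //.
  rewrite /g (bigD1 j) //= eqxx mulrDr mulr1 -exprM mulnC exprM.
  have -> : 8^-1 ^+ 2 = 64^-1 :> R by rewrite expr2; field.
  by rewrite lerDl mulr_ge0 ?exprn_ge0 ?sumr_ge0 // invr_ge0.
have main k : 2 ^+ k <= 2 * S.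
  have [_ wk] := MP k.
  have := @riesz_product R (16 ^ k) (M k) f S (conj cR cI) fS.
  move=> /(_ (fun e eu => fout _ (riesz_freq_notin wk eu))); apply: le_trans.
  have -> : 2 ^+ k = \sum_(j < 16 ^ k) 8^-1 ^+ k :> R.
    rewrite sumr_const card_ord -[RHS]mulr_natl natrX -exprMn.
    by congr (_ ^+ _); field.
  apply: ler_sum => j _; apply: le_trans (low k j) _.
  by rewrite -lecR -!normc_cmod; apply: fin; exact: NA.
have := main (Num.truncn (2 * S)).+1.
have S0 : 0 <= 2 * S by apply: le_trans (main 0%N).
have /andP[_ h] := truncn_itv S0.
rewrite leNgt => /negP; apply; apply: lt_trans h _.
by rewrite -natrX ltr_nat ltn_expl.
Qed.

End NotMassive.

Theorem corollary1p6 (R : realType) (r : nat -> R)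
  (r_incr : {homo r : m n / (m <= n)%N >-> m <= n})
  (r_bound : forall n, 0 < r n < 2 ^ (n%:Z - 10)) :
  massive R (dyadic_intervals r) <->
  exists2 eps : R, 0 < eps & forall n, eps * 2 ^+ n < r n.
Proof.
split=> [mass|[eps eps0 epsr]]; last exact: massive_dyadic epsr.
by apply: contrapT => noeps; exact: not_massive noeps mass.
Qed.
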